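(* (1) Any $3$-IET that belongs to $\mathcal G_0$ is periodic, and so is the product of two involutions of $\mathcal G$. (2) There exists a $4$-IET $f\in\mathcal G_0$ that is not reversible in $\mathcal G$. (3) Any element of $\mathcal G_0$ that is a product of $2$ restricted rotations with respective supports $I_1$ and $I_2=[0,1)\setminus I_1$, satisfying $|I_1|=\frac{p}{p+1}$ with $p\in\mathbb N^*$ (a positive integer), can be written as a product of $6$ involutions of $\mathcal G$.
   Context: An interval exchange transformation (IET) is a bijection of $[0,1)$ defined by a finite partition of $[0,1)$ into half-open subintervals and a reordering of these intervals by translations; it is an $r$-IET if the partition has cardinality $r$. $\mathcal G$ is the group of all IETs. An element is periodic if it has finite order; an involution is an element whose square is the identity; $f$ is reversible in $\mathcal G$ if $hfh^{-1}=f^{-1}$ for some $h\in\mathcal G$. The Sah–Arnoux–Fathi invariant of an IET $f$ exchanging $r$ intervals of lengths $\lambda_1,\dots,\lambda_r$ with corresponding translation constants $\gamma_1,\dots,\gamma_r$ (so $f(x)=x+\gamma_k$ on the $k$-th interval) is $SAF(f)=\sum_{k=1}^r\lambda_k\otimes\gamma_k\in\mathbb R\otimes_{\mathbb Q}\mathbb R$. $\mathcal G_0$ is the subgroup of $\mathcal G$ of IETs with $SAF(f)=0$. A restricted rotation is an IET $g$ whose support is an interval $I$ and such that a direct (orientation preserving) affine map from $I$ to $[0,1)$ conjugates $g|_I$ to a $2$-IET. $|J|$ denotes the length of an interval $J$; here $I_1$ and $I_2$ are half-open intervals. *)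

(* Defs.v *)
From HB Require Import structures.
From mathcomp Require Import all_boot all_order all_algebra.
From mathcomp Require Import mathcomp_extra boolp classical_sets functions.
From mathcomp Require Import set_interval reals.
From mathcomp.multinomials Require Import freeg.

Set Implicit Arguments.
Unset Strict Implicit.
Unset Printing Implicit Defensive.

Import Order.TTheory GRing.Theory Num.Theory.

Local Open Scope classical_set_scope.
Local Open Scope ring_scope.

Section Tensor.
Context {R : realType}.

(* The subgroup of the free abelian group on R * R generated by the relations
   of the tensor product over the rationals. *)
Inductive tensor_rel : {freeg (R * R)%type} -> Prop :=
| tensor_rel0 : tensor_rel 0
| tensor_relB u v : tensor_rel u -> tensor_rel v -> tensor_rel (u - v)
| tensor_relDl x y z :
    tensor_rel (<< (x + y, z) >> - (<< (x, z) >> + << (y, z) >>))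
| tensor_relDr x y z :
    tensor_rel (<< (x, y + z) >> - (<< (x, y) >> + << (x, z) >>))
| tensor_relQ (q : rat) x y :
    tensor_rel (<< (ratr q * x, y) >> - << (x, ratr q * y) >>).

Definition tensor_relb : {pred {freeg (R * R)%type}} :=
  fun u => `[< tensor_rel u >].

Lemma tensor_relb_zmod_closed : zmod_closed tensor_relb.
Proof.
split; first exact/asboolP/tensor_rel0.
by move=> u v /asboolP hu /asboolP hv; exact/asboolP/tensor_relB.
Qed.

HB.instance Definition _ :=
  GRing.isZmodClosed.Build _ tensor_relb tensor_relb_zmod_closed.

End Tensor.
Arguments tensor_relb R : clear implicits.

(* The additive group of the tensor product of R with R over the rationals. *)
Definition tensor (R : realType) : Type := Quotient.quot (tensor_relb R).
HB.instance Definition _ (R : realType) := GRing.Zmodule.on (tensor R).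

Definition tens {R : realType} (x y : R) : tensor R :=
  (\pi_(Quotient.quot (tensor_relb R)) << (x, y) >>)%qT.

Section TensorTheory.
Context {R : realType}.
Implicit Types x y z : R.

Lemma tensDl x y z : tens (x + y) z = tens x z + tens y z.
Proof.
rewrite /tens -[RHS](raddfD (\pi_(Quotient.quot (tensor_relb R)))%qT).
apply/eqP; rewrite -Quotient.idealrBE; exact/asboolP/tensor_relDl.
Qed.

Lemma tensDr x y z : tens x (y + z) = tens x y + tens x z.
Proof.
rewrite /tens -[RHS](raddfD (\pi_(Quotient.quot (tensor_relb R)))%qT).
apply/eqP; rewrite -Quotient.idealrBE; exact/asboolP/tensor_relDr.
Qed.

Lemma tensQ (q : rat) x y : tens (ratr q * x) y = tens x (ratr q * y).
Proof. by apply/eqP; rewrite -Quotient.idealrBE; exact/asboolP/tensor_relQ. Qed.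

Lemma tens0l y : tens 0 y = 0.
Proof. by apply: (addrI (tens 0 y)); rewrite -tensDl !addr0. Qed.

Lemma tens_suml I (s : seq I) (P : pred I) (F : I -> R) y :
  tens (\sum_(i <- s | P i) F i) y = \sum_(i <- s | P i) tens (F i) y.
Proof.
apply: (big_morph (fun x => tens x y)); last exact: tens0l.
by move=> a b; exact: tensDl.
Qed.

Lemma tens_lift (V : zmodType) (B : R -> R -> V) :
  (forall x y z, B (x + y) z = B x z + B y z) ->
  (forall x y z, B x (y + z) = B x y + B x z) ->
  (forall (q : rat) x y, B (ratr q * x) y = B x (ratr q * y)) ->
  exists2 phi : tensor R -> V, {morph phi : u v / u + v}
    & forall x y, phi (tens x y) = B x y.
Proof.
move=> BDl BDr BQ; pose b (p : R * R) : zmodule V := B p.1 p.2.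
pose L : {freeg (R * R)%type} -> V := fglift b.
have L_sub u v : L (u - v) = L u - L v by exact: (@lift_is_additive _ _ _ b).
have L0 : L 0 = 0 by rewrite -[X in L X](subrr 0) L_sub subrr.
have L_add u v : L (u + v) = L u + L v.
  by rewrite -[v in LHS]opprK -[- v]sub0r !L_sub L0 sub0r opprK.
have LU x y : L << (x, y) >> = B x y by rewrite /L liftU scale1r.
have L_rel u : tensor_rel u -> L u = 0.
  elim=> [|{}u v _ Lu _ Lv|x y z|x y z|q x y]; rewrite ?L_sub ?L_add ?LU.
  - exact: L0.
  - by rewrite Lu Lv subrr.
  - by rewrite BDl subrr.
  - by rewrite BDr subrr.
  - by rewrite BQ subrr.
have L_pi u : L (repr (\pi_(Quotient.quot (tensor_relb R)) u)%qT) = L u.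
  set w := repr _; have : w - u \in tensor_relb R by rewrite Quotient.idealrBE reprK.
  by move/asboolP/L_rel/eqP; rewrite L_sub subr_eq0 => /eqP.
exists (fun u : tensor R => L (repr u)) => [u v | x y]; last first.
  by rewrite L_pi LU.
rewrite -[u in LHS]reprK -[v in LHS]reprK -L_add -[RHS]L_pi; congr (L (repr _)).
exact/esym/(raddfD (\pi_(Quotient.quot (tensor_relb R)))%qT).
Qed.

End TensorTheory.

Section IET.
Context {R : realType}.
Implicit Types (f g : R -> R) (x y : R).

(* Left endpoint of the n-th of r consecutive intervals of lengths lam. *)
Definition endpoint r (lam : 'I_r -> R) (n : nat) : R :=
  \sum_(j < r | (j < n)%N) lam j.

(* [0, 1) is cut, from left to right, into r intervals of lengths lam, and f
   translates the k-th one by gam k. *)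
Definition exchanges r f (lam gam : 'I_r -> R) : Prop :=
  [/\ forall k, 0 < lam k, \sum_k lam k = 1 &
      forall (k : 'I_r) x, endpoint lam k <= x < endpoint lam k.+1 ->
        f x = x + gam k].

(* A bijection of [0, 1) is encoded by its extension by the identity to R, so
   that equality and composition of IETs are those of functions. *)
Definition is_iet f : Prop :=
  [/\ set_bij `[0, 1[ `[0, 1[ f, forall x, ~~ (0 <= x < 1) -> f x = x &
      exists r (lam gam : 'I_r -> R), exchanges f lam gam].

Lemma endpointS r (lam : 'I_r -> R) (k : 'I_r) :
  endpoint lam k.+1 = endpoint lam k + lam k.
Proof.
rewrite /endpoint (bigD1 k) //= addrC; congr (_ + _); apply: eq_bigl => j.
by rewrite ltnS [RHS]ltn_neqAle andbC.
Qed.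

Lemma endpoint0 r (lam : 'I_r -> R) : endpoint lam 0 = 0.
Proof. by rewrite /endpoint big_pred0. Qed.

Lemma endpoint_max r (lam : 'I_r -> R) : endpoint lam r = \sum_k lam k.
Proof. by apply: eq_bigl => j; rewrite ltn_ord. Qed.

Lemma endpoint_find r (lam : 'I_r -> R) x :
  0 <= x < \sum_k lam k ->
  exists k : 'I_r, endpoint lam k <= x < endpoint lam k.+1.
Proof.
rewrite -endpoint_max => /andP[x0 xr].
suff H n : (n <= r)%N -> x < endpoint lam n ->
    exists k : 'I_r, endpoint lam k <= x < endpoint lam k.+1 by exact: H xr.
elim: n => [|n IH] nr; first by rewrite endpoint0 ltNge x0.
have [xn _|nx xn1] := ltP x (endpoint lam n); first exact: IH (ltnW nr) xn.
by exists (Ordinal nr); rewrite nx xn1.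
Qed.

Lemma endpoint_ge0 r (lam : 'I_r -> R) n :
  (forall k, 0 < lam k) -> 0 <= endpoint lam n.
Proof. by move=> lam0; apply: sumr_ge0 => j _; exact: ltW. Qed.

Lemma endpoint_le r (lam : 'I_r -> R) m n :
  (forall k, 0 < lam k) -> (m <= n)%N -> endpoint lam m <= endpoint lam n.
Proof.
move=> lam0 mn; rewrite /endpoint [leRHS](bigID (fun j : 'I_r => (j < m)%N)) /=.
rewrite [X in _ <= X + _](eq_bigl (fun j : 'I_r => (j < m)%N)); last first.
  by move=> j; rewrite andbC; case: ltnP => //= jm; exact: leq_trans jm mn.
by rewrite lerDl; apply: sumr_ge0 => j _; exact: ltW.
Qed.

(* f has no discontinuity in [0, 1) outside D. *)
Definition translates_off (D : seq R) f : Prop :=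
  forall x y, 0 <= x -> x <= y -> y < 1 ->
    (forall d, d \in D -> ~~ (x < d <= y)) -> f y = f x + (y - x).

Lemma exchanges_translates_off r f (lam gam : 'I_r -> R) :
  exchanges f lam gam -> exists D, translates_off D f.
Proof.
move=> [lam0 lam1 fE]; exists [seq endpoint lam n | n <- iota 0 r.+1].
move=> x y x0 xy y1 xyD.
have [|k xk] := @endpoint_find _ lam x.
  by rewrite x0 lam1 (le_lt_trans xy y1).
have yk : endpoint lam k <= y < endpoint lam k.+1.
  have /andP[kx xk1] := xk; rewrite (le_trans kx xy) /= ltNge; apply/negP => ky.
  have := xyD (endpoint lam k.+1); rewrite xk1 ky => /(_ _)/negP; apply=> //.
  by apply: map_f; rewrite mem_iota ltnS ltn_ord.
by rewrite (fE k) // (fE k x) // addrAC addrCA subrr addr0 addrC.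
Qed.

Lemma translates_off_exchanges D f : translates_off D f ->
  exists r (lam gam : 'I_r -> R), exchanges f lam gam.
Proof.
move=> fD.
pose s := sort <=%R (undup (0 :: [seq d <- D | 0 < d < 1])).
have s_mem d : (d \in s) = (d == 0) || ((d \in D) && (0 < d < 1)).
  by rewrite mem_sort mem_undup inE mem_filter andbC.
have s_lt : sorted <%R s.
  by rewrite sort_lt_sorted undup_uniq.
have s_bnd d : d \in s -> 0 <= d < 1.
  by rewrite s_mem => /orP[/eqP->|/andP[_ /andP[/ltW-> ->]]//]; rewrite lexx ltr01.
pose e := nth 1 s; pose r := size s.
have r0 : (0 < r)%N.
  have : 0 \in s by rewrite s_mem eqxx.
  by rewrite /r; case: (s).
have e_lt i j : (i < j <= r)%N -> e i < e j.
  case/andP=> ij; rewrite leq_eqVlt => /orP[/eqP jr|jr].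
    rewrite jr /e (nth_default _ (leqnn _)).
    by have /andP[] := s_bnd _ (mem_nth 1 (leq_ltn_trans (leqnn _) (etrans (congr1 _ (esym jr)) ij) : (i < size s)%N)).
  by apply: (sorted_ltn_nth lt_trans) => //; rewrite inE // (ltn_trans ij jr).
have e0 : e 0%N = 0.
  have s0 : 0 \in s by rewrite s_mem eqxx.
  apply/eqP; rewrite eq_le; have /andP[-> _] := s_bnd _ (mem_nth 1 r0).
  rewrite andbT -(nth_index 1 s0); have [->//|i0] := posnP (index 0 s).
  by apply/ltW/e_lt; rewrite i0 index_size.
pose lam (k : 'I_r) := e k.+1 - e k; pose gam (k : 'I_r) := f (e k) - e k.
have endE n : (n <= r)%N -> endpoint lam n = e n.
  elim: n => [|n IH] nr; first by rewrite endpoint0 e0.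
  by rewrite (endpointS lam (Ordinal nr)) IH ?(ltnW nr)// /lam /= addrC subrK.
exists r, lam, gam; split => [k||k x].
- by rewrite subr_gt0; apply: e_lt; rewrite ltnSn ltn_ord.
- by rewrite -endpoint_max endE // /e nth_default.
rewrite !endE ?(ltnW (ltn_ord k))// => /andP[kx xk].
have ks : e k \in s by exact: mem_nth.
have /andP[ek0 ek1] := s_bnd _ ks.
have x1 : x < 1.
  apply: lt_le_trans xk _; have := ltn_ord k; rewrite leq_eqVlt.
  case/orP=> [/eqP->|kr]; first by rewrite /e nth_default.
  by have /andP[_ /ltW] := s_bnd _ (mem_nth 1 kr).
rewrite (fD (e k) x) //; first by rewrite /gam addrCA addrA.
move=> d dD; apply/negP => /andP[kd dx].
have ds : d \in s.
  by rewrite s_mem dD (le_lt_trans ek0 kd) (le_lt_trans dx x1) orbT.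
have dr : (index d s < r)%N by rewrite index_mem.
have dE : e (index d s) = d by exact: nth_index.
have [dk|kd'] := leqP (index d s) k.
  move: kd; rewrite -dE ltNge; move: dk; rewrite leq_eqVlt.
  case/orP=> [/eqP->|dk]; first by rewrite lexx.
  by rewrite ltW // e_lt // dk ltnW.
have : e k.+1 <= d.
  rewrite -dE; move: kd'; rewrite leq_eqVlt => /orP[/eqP->|kd'] //.
  by rewrite ltW // e_lt // kd' ltnW.
by rewrite leNgt (le_lt_trans dx xk).
Qed.

Lemma is_ietP f : is_iet f <->
  [/\ set_bij `[0, 1[ `[0, 1[ f, forall x, ~~ (0 <= x < 1) -> f x = x &
      exists D, translates_off D f].
Proof.
split=> -[fb fo fx]; split=> //.
  by have [r [lam [gam]]] := fx; exact: exchanges_translates_off.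
by have [D] := fx; exact: translates_off_exchanges.
Qed.

Lemma is_iet_bnd f x : is_iet f -> (0 <= f x < 1) = (0 <= x < 1).
Proof.
case=> [[fI _ _] fo _]; have [x01|xN] := boolP (0 <= x < 1).
  by have := fI x; rewrite /= !in_itv /=; exact.
by rewrite fo // (negbTE xN).
Qed.

Lemma is_iet_inj f : is_iet f -> injective f.
Proof.
move=> fi x y fxy; have := is_iet_bnd x fi; rewrite fxy (is_iet_bnd y fi).
have [[_ finj _] fo _] := fi.
have [y01 x01|yN xN] := boolP (0 <= y < 1); last first.
  by rewrite -(fo x) -?xN // fxy fo.
by apply: finj; rewrite ?inE /= ?in_itv /= -?x01.
Qed.

Lemma is_iet_surj f y : is_iet f -> exists x, f x = y.
Proof.
case=> [[_ _ fs] fo _]; have [y01|yN] := boolP (0 <= y < 1); last first.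
  by exists y; exact: fo.
by have [|x _ <-] := fs y; [rewrite /= in_itv | exists x].
Qed.

Lemma is_iet_id : is_iet (@id R).
Proof.
apply/is_ietP; split=> //.
  split; [by move=> x | by move=> ? ? _ _ | by move=> x ?; exists x].
by exists [::] => x y *; rewrite addrC subrK.
Qed.

Lemma is_iet_bij f : injective f -> (forall y, exists x, f x = y) ->
  (forall x, (0 <= f x < 1) = (0 <= x < 1)) -> set_bij `[0, 1[ `[0, 1[ f.
Proof.
move=> finj fs fb; split.
- by move=> x; rewrite /= !in_itv /= fb.
- by move=> x y _ _; exact: finj.
- move=> y; rewrite /= in_itv /=; have [x <-] := fs y; rewrite fb => x01.
  by exists x => //=; rewrite in_itv.
Qed.

Lemma is_iet_comp f g : is_iet f -> is_iet g -> is_iet (f \o g).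
Proof.
move=> fi gi; apply/is_ietP.
have [_ fo [Df fD]] := (is_ietP f).1 fi; have [_ go [Dg gD]] := (is_ietP g).1 gi.
split.
- apply: is_iet_bij => [|y|x].
  + exact: inj_comp (is_iet_inj fi) (is_iet_inj gi).
  + have [z <-] := is_iet_surj y fi; have [x <-] := is_iet_surj z gi.
    by exists x.
  + by rewrite /= is_iet_bnd // is_iet_bnd.
- by move=> x xN /=; rewrite go // fo.
pose h d := xget 0 [set x | g x = d].
exists (Dg ++ [seq h d | d <- Df]) => x y x0 xy y1 xyD /=.
have gT w : x <= w -> w <= y -> g w = g x + (w - x).
  move=> xw wy; apply: gD => //; first exact: le_lt_trans wy y1.
  move=> d dD; apply/negP=> /andP[xd dw].
  have := xyD d; rewrite mem_cat dD => /(_ isT).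
  by rewrite xd (le_trans dw wy).
have gx : 0 <= g x < 1 by rewrite is_iet_bnd // x0 (le_lt_trans xy y1).
have gy : 0 <= g y < 1 by rewrite is_iet_bnd // y1 (le_trans x0 xy).
have /andP[gx0 _] := gx; have /andP[_ gy1] := gy.
have gyE := gT y xy (lexx y).
rewrite (fD (g x) (g y)) //; last 2 first.
- by rewrite gyE lerDl subr_ge0.
- move=> d dD; apply/negP => /andP[xd dy].
  pose w := x + (d - g x).
  have xw : x < w by rewrite ltrDl subr_gt0.
  have wy : w <= y.
    by rewrite /w -lerBrDl lerBlDl -gyE.
  have gw : g w = d by rewrite gT ?(ltW xw)// /w [x + _]addrC addrK addrC subrK.
  have hd : h d = w.
    rewrite /h; case: xgetP => [z _ /= gz|/(_ w)]; last by rewrite /= gw.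
    by apply: (is_iet_inj gi); rewrite gz.
  have wD : w \in Dg ++ [seq h d | d <- Df].
    by rewrite mem_cat -[w in X in _ || X]hd (map_f h dD) orbT.
  by have := xyD _ wD; rewrite xw wy.
by rewrite gyE addrAC subrr add0r.
Qed.

Definition fun_inv f y : R := xget 0 [set x | f x = y].

Lemma fun_invK f : is_iet f -> cancel (fun_inv f) f.
Proof.
move=> fi y; rewrite /fun_inv; case: xgetP => [z _ //|].
by have [x fx] := is_iet_surj y fi => /(_ x).
Qed.

Lemma funK_inv f : is_iet f -> cancel f (fun_inv f).
Proof. by move=> fi x; apply: (is_iet_inj fi); rewrite fun_invK. Qed.

Lemma is_iet_inv f : is_iet f -> is_iet (fun_inv f).
Proof.
move=> fi; apply/is_ietP; have [_ fo [D fD]] := (is_ietP f).1 fi.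
have fK := funK_inv fi; have Kf := fun_invK fi.
have gb x : (0 <= fun_inv f x < 1) = (0 <= x < 1) by rewrite -(is_iet_bnd _ fi) Kf.
split.
- by apply: is_iet_bij => // [|y]; [exact: can_inj Kf | exists (f y)].
- by move=> x xN; rewrite -[x in LHS]fo // fK.
exists [seq f d | d <- 0 :: D] => x y x0 xy y1 xyD.
set u := fun_inv f x.
have x1 := le_lt_trans xy y1; have y0 := le_trans x0 xy.
have : 0 <= u < 1 by rewrite gb x0.
case/andP=> u0 u1; have fu : f u = x by exact: Kf.
have [c [uc c1 cD fc]] : exists c, [/\ u < c, c <= 1,
    (c = 1) \/ (c \in D) & forall v, u <= v -> v < c -> f v = f u + (v - u)].
  have [c [uc c1 cD cm]] : exists c, [/\ u < c, c <= 1, (c = 1) \/ (c \in D) &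
      forall d, d \in D -> u < d -> c <= d].
    elim: (D) => [|d E [c [uc c1 cE cm]]]; first by exists 1; split=> //; left.
    have [ud|ud] := ltP u d; last first.
      exists c; split=> // [|d']; first by case: cE => [|cE]; [left|right; rewrite inE cE orbT].
      rewrite inE => /orP[/eqP->|]; first by rewrite ltNge ud.
      exact: cm.
    have [cd|dc] := leP c d.
      exists c; split=> // [|d']; first by case: cE => [|cE]; [left|right; rewrite inE cE orbT].
      by rewrite inE => /orP[/eqP->//|]; exact: cm.
    exists d; split=> //; first exact: le_trans (ltW dc) c1.
      by right; rewrite mem_head.
    move=> d'; rewrite inE => /orP[/eqP->//|d'E ud'].
    exact: le_trans (ltW dc) (cm _ d'E ud').
  exists c; split=> // v uv vc; apply: fD => //; first exact: lt_le_trans vc c1.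
  move=> d dD; apply/negP => /andP[ud dv].
  by have := lt_le_trans vc (cm _ dD ud); rewrite ltNge dv.
have [vc|cv] := ltP (u + (y - x)) c.
  have fE : f (u + (y - x)) = y.
    by rewrite fc ?lerDl ?subr_ge0 // fu [u + _]addrC addrK addrC subrK.
  by rewrite -[y in LHS]fE fK.
exfalso; pose z := x + (c - u).
have xz : x < z by rewrite ltrDl subr_gt0.
have zy : z <= y by rewrite /z -lerBrDl lerBlDl.
pose w := fun_inv f z; have fw : f w = z by exact: Kf.
have : 0 <= w < 1 by rewrite gb (le_trans x0 (ltW xz)) (le_lt_trans zy y1).
case/andP=> w0 w1.
have wD : w \notin 0 :: D.
  apply/negP => wD; have := xyD _ (map_f f wD).
  by rewrite fw xz zy.
have [w00|w00] := eqVneq w 0; first by rewrite w00 mem_head in wD.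
have wgt0 : 0 < w by rewrite lt_neqAle eq_sym w00.
have [t [t0 tw ft]] : exists t, [/\ 0 <= t, t < w &
    forall v, t <= v -> v <= w -> f w = f v + (w - v)].
  have [t [t0 tw tm]] : exists t, [/\ 0 <= t, t < w &
      forall d, d \in D -> d <= w -> d <= t].
    have : w \notin D by apply: contra wD; rewrite inE orbC => ->.
    elim: (D) => [|d E IH]; first by exists 0; split.
    rewrite inE negb_or => /andP[wd /IH[t [t0 tw tm]]].
    have [dw|wd'] := ltP d w; last first.
      exists t; split=> // d'; rewrite inE => /orP[/eqP-> dw|]; last exact: tm.
      by move: wd; rewrite eq_le dw wd'.
    exists (Num.max t d); split; rewrite ?le_max ?t0 ?gt_max ?tw //.
    move=> d'; rewrite inE le_max => /orP[/eqP->|d'E d'w].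
      by rewrite lexx orbT.
    by rewrite tm.
  exists t; split=> // v tv vw; apply: fD => //; first exact: le_trans t0 tv.
  move=> d dD; apply/negP => /andP[vd dw].
  by have := tm _ dD dw; rewrite leNgt (le_lt_trans tv vd).
pose eps := Num.min (w - t) (c - u).
have eps0 : 0 < eps by rewrite lt_min !subr_gt0 tw uc.
have e1 : eps <= w - t by rewrite ge_min lexx.
have e2 : eps <= c - u by rewrite ge_min lexx orbT.
have h1 := ft (w - eps).
have h2 := fc (c - eps).
have wc : w - eps = c - eps.
  apply: (is_iet_inj fi); rewrite h2 ?fu; last 2 first.
  - by rewrite lerBrDl -lerBrDr.
  - by rewrite ltrBlDr ltrDl.
  apply: (addIr eps); have -> : f (w - eps) + eps = z.
    rewrite -fw h1; first by rewrite subKr.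
    + by rewrite lerBrDl -lerBrDr.
    + by rewrite lerBlDr lerDl ltW.
  by rewrite /z -addrA addrAC subrK.
have {}wc : w = c by exact: addIr wc.
case: cD => [c1'|cD]; first by move: w1; rewrite wc c1' ltxx.
by move: wD; rewrite inE wc cD orbT.
Qed.

End IET.


Record iet (R : realType) : Type := Iet {
  iet_fun :> R -> R;
  iet_fun_is_iet : `[< is_iet iet_fun >] }.

HB.instance Definition _ (R : realType) := [isSub for @iet_fun R].
HB.instance Definition _ (R : realType) := gen_eqMixin (iet R).
HB.instance Definition _ (R : realType) := gen_choiceMixin (iet R).

Section IETGroup.
Context {R : realType}.
Implicit Types f g h : iet R.

Lemma ietP f : is_iet f.
Proof. exact/asboolP/iet_fun_is_iet. Qed.

Definition mkiet (f : R -> R) (fi : is_iet f) : iet R := Iet (asboolT fi).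

Lemma iet_ext f g : f =1 g -> f = g.
Proof. by move=> fg; apply: val_inj; apply/funext. Qed.

Definition iet_one : iet R := mkiet is_iet_id.
Definition iet_mul f g : iet R := mkiet (is_iet_comp (ietP f) (ietP g)).
Definition iet_inv f : iet R := mkiet (is_iet_inv (ietP f)).

Lemma iet_mulA : associative iet_mul.
Proof. by move=> f g h; exact: iet_ext. Qed.

Lemma iet_mul1 : left_id iet_one iet_mul.
Proof. by move=> f; exact: iet_ext. Qed.

Lemma iet_mulr1 : right_id iet_one iet_mul.
Proof. by move=> f; exact: iet_ext. Qed.

Lemma iet_mulV : left_inverse iet_one iet_inv iet_mul.
Proof. by move=> f; apply: iet_ext => x; exact: (funK_inv (ietP f)). Qed.

Lemma iet_mulrV : right_inverse iet_one iet_inv iet_mul.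
Proof. by move=> f; apply: iet_ext => x; exact: (fun_invK (ietP f)). Qed.

End IETGroup.

HB.instance Definition _ (R : realType) := isGroup.Build (iet R)
  iet_mulA iet_mul1 iet_mulr1 iet_mulV iet_mulrV.

Lemma ietME (R : realType) (f g : iet R) x : (f * g)%g x = f (g x).
Proof. by []. Qed.

Lemma iet1E (R : realType) x : (1%g : iet R) x = x.
Proof. by []. Qed.

Lemma ietVK (R : realType) (f : iet R) : cancel f (f^-1)%g.
Proof. exact: (funK_inv (ietP f)). Qed.

Lemma ietKV (R : realType) (f : iet R) : cancel (f^-1)%g f.
Proof. exact: (fun_invK (ietP f)). Qed.

Section Notions.
Context {R : realType}.
Implicit Types f g h : iet R.

(* Some of the r intervals may be translated by the same amount. *)
Definition is_riet r f : Prop := exists lam gam : 'I_r -> R, exchanges f lam gam.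

Definition SAF_of r (lam gam : 'I_r -> R) : tensor R :=
  \sum_k tens (lam k) (gam k).

(* The choice of (lam, gam) is irrelevant, see SAFE. *)
Definition SAF f : tensor R :=
  xget 0 [set t | exists r (lam gam : 'I_r -> R),
                    exchanges f lam gam /\ t = SAF_of lam gam].

Definition G0 : set (iet R) := [set f | SAF f = 0].

Definition periodic f : Prop := exists2 n, (0 < n)%N & (f ^+ n = 1)%g.

Definition involution f : Prop := (f ^+ 2 = 1)%g.

Definition reversible f : Prop := exists h, (h * f * h^-1 = f^-1)%g.

Definition prod_involutions n f : Prop :=
  exists2 i : 'I_n -> iet R, forall k, involution (i k)
                           & f = (\prod_(k < n) i k)%g.

Definition support f : set R := [set x | f x != x].

(* x |-> (x - a) / (b - a) is the only increasing affine bijection from [a, b)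
   to [0, 1). *)
Definition restricted_rotation g (a b : R) : Prop :=
  [/\ a < b, support g = `[a, b[%classic &
      exists2 t : iet R, is_riet 2 t &
        forall x, a <= x < b -> t ((x - a) / (b - a)) = (g x - a) / (b - a)].

Let clamp (a b t : R) := Num.min (Num.max t a) b.

Let clamp_diff0 (a b s t : R) : a <= b -> s <= t -> (b <= s) || (t <= a) ->
  clamp a b t - clamp a b s = 0.
Proof.
move=> ab st /orP[bs|ta]; apply/eqP; rewrite subr_eq0 /clamp; apply/eqP.
  rewrite (min_idPr _) ?le_max ?(le_trans bs st) //.
  by rewrite (min_idPr _) // le_max bs.
by rewrite (max_idPr ta) (max_idPr (le_trans st ta)).
Qed.

Let clamp_sym (a b s t : R) : a <= b -> s <= t ->
  clamp a b t - clamp a b s = clamp s t b - clamp s t a.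
Proof.
move=> ab st.
have [bs|sb] := leP b s.
  by rewrite clamp_diff0 ?bs// clamp_diff0 // bs orbT.
have [ta|at_] := leP t a.
  by rewrite clamp_diff0 ?ta ?orbT// clamp_diff0 // ta.
rewrite /clamp.
rewrite [Num.max t a](max_idPl (ltW at_)) [Num.max b s](max_idPl (ltW sb)).
have [sa|as_] := leP s a.
  rewrite (min_idPl ab) (min_idPl (ltW at_)) (minC t b) //.
by rewrite (min_idPl st) (min_idPl (ltW sb)) (minC t b).
Qed.

Let clamp_sum r (lam : 'I_r -> R) (a b : R) : 0 <= a -> a <= b -> b <= 1 ->
  \sum_k lam k = 1 ->
  \sum_(k < r) (clamp a b (endpoint lam k.+1) - clamp a b (endpoint lam k)) = b - a.
Proof.
move=> a0 ab b1 lam1.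
rewrite -(big_mkord xpredT
  (fun n => clamp a b (endpoint lam n.+1) - clamp a b (endpoint lam n))).
rewrite (telescope_sumr (fun n => clamp a b (endpoint lam n))) //.
rewrite endpoint_max lam1 endpoint0 /clamp (max_idPr a0) (min_idPl ab).
by rewrite (max_idPl (le_trans ab b1)) (min_idPr b1).
Qed.

Lemma SAF_of_unique f r r' (lam gam : 'I_r -> R) (lam' gam' : 'I_r' -> R) :
  exchanges f lam gam -> exchanges f lam' gam' ->
  SAF_of lam gam = SAF_of lam' gam'.
Proof.
move=> [lam0 lam1 fE] [lam0' lam1' fE'].
pose e := endpoint lam; pose e' := endpoint lam'.
have sumE q q' (l : 'I_q -> R) (l' : 'I_q' -> R) (k : 'I_q) :
    (forall k, 0 < l k) -> \sum_k l k = 1 -> \sum_k l' k = 1 ->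
    l k = \sum_(i < q') (clamp (endpoint l k) (endpoint l k.+1) (endpoint l' i.+1)
                        - clamp (endpoint l k) (endpoint l k.+1) (endpoint l' i)).
  move=> l0 l1 l1'; rewrite clamp_sum // ?endpoint_ge0 // ?endpoint_le //.
    by rewrite endpointS addrAC subrr add0r.
  by rewrite -l1 -endpoint_max endpoint_le.
rewrite /SAF_of.
under eq_bigr => k _ do rewrite (sumE _ _ lam lam' k) // tens_suml.
under [RHS]eq_bigr => k _ do rewrite (sumE _ _ lam' lam k) // tens_suml.
rewrite exchange_big /=; apply: eq_bigr => i _; apply: eq_bigr => k _.
have ek := endpoint_le lam0 (leqnSn k); have ei := endpoint_le lam0' (leqnSn i).
rewrite [in RHS]clamp_sym //.
have [/clamp_diff0->//|] :=
  boolP ((endpoint lam k.+1 <= endpoint lam' i) || (endpoint lam' i.+1 <= endpoint lam k)).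
  by rewrite !tens0l.
rewrite negb_or -!ltNge => /andP[ik ki]; congr tens.
pose x := Num.max (endpoint lam k) (endpoint lam' i).
have xk : endpoint lam k <= x < endpoint lam k.+1.
  by rewrite le_max lexx gt_max ik endpointS ltrDl lam0.
have xi : endpoint lam' i <= x < endpoint lam' i.+1.
  by rewrite le_max lexx orbT gt_max ki endpointS ltrDl lam0'.
by apply: (addrI x); rewrite -fE // -fE'.
Qed.

Lemma SAFE f r (lam gam : 'I_r -> R) :
  exchanges f lam gam -> SAF f = SAF_of lam gam.
Proof.
move=> fE; rewrite /SAF; case: xgetP => [t _ /= [q [l [g [fE' ->]]]]|].
  exact: SAF_of_unique fE' fE.
by move=> /(_ (SAF_of lam gam)); case; exists r, lam, gam.
Qed.

End Notions.

(* Main.v *)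
Require Import Defs.
From mathcomp Require Import all_boot all_order all_algebra.
From mathcomp Require Import boolp classical_sets functions set_interval reals.
From mathcomp Require Import ring lra zify.

(* (1) A 3-IET with vanishing SAF invariant has all its translations in d Z for
   some d > 0: they are integral combinations of two reals u, v with
   SAF = u (x) v - v (x) u, and this tensor vanishes only if u and v are
   commensurable. Orbits then lie in cosets of d Z, so they are finite of bounded
   length, and a periodic map is a product of two involutions.

   (2) Rotate [0, 2/3) by s = sqrt 2 - 1 and [2/3, 1) by t = 1 - 2 s. The SAF
   invariant vanishes because (2/3) s + (1/3) t is rational. If h conjugated f to
   its inverse, h would move f^n 0 by -n (s + e) modulo 1/3 up to a constant, with
   e = s or e = t; since h has finitely many translations, s + e would be rational.

   (3) Cut [0, 1) into N = p + 1 cells of length 1/N. By SAF = 0, f moves the j-th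
   cell by v_j modulo 1/N, with v_0 + ... + v_(N-1) rational. If c is the rotation
   by 1/N and w rotates the j-th cell by v_0 + ... + v_j, then f is, up to a
   periodic map, the commutator w c w^-1 c^-1, so f is a product of three periodic
   maps. *)

Set Implicit Arguments.
Unset Strict Implicit.
Unset Printing Implicit Defensive.

Import Order.TTheory GRing.Theory Num.Theory.

Local Open Scope classical_set_scope.
Local Open Scope ring_scope.

(** * Periodic interval exchanges *)

Lemma pigeonhole (T : finType) (g : nat -> T) :
  exists i j : nat, [/\ (i < j)%N, (j <= #|T|)%N & g i = g j].
Proof.
have /injectivePn[i [j ij gij]] : ~~ injectiveb (fun k : 'I_#|T|.+1 => g k).
  apply/negP => /injectiveP/leq_card; rewrite card_ord.
  by rewrite ltnn.
have [lij|lji|/val_inj eij] := ltngtP i j; last by rewrite eij eqxx in ij.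
- by exists i, j; rewrite lij -ltnS ltn_ord.
- by exists j, i; rewrite lji -ltnS ltn_ord.
Qed.

Section Periodic.
Context {R : realType}.
Implicit Types (f g h : iet R) (d x y : R).

Lemma iet_out f x : ~~ (0 <= x < 1) -> f x = x.
Proof. by case: (ietP f) => _ + _; exact. Qed.

Lemma iet_bnd f x : (0 <= f x < 1) = (0 <= x < 1).
Proof. exact/is_iet_bnd/ietP. Qed.

Lemma iet_inj f : injective f.
Proof. exact/is_iet_inj/ietP. Qed.

Lemma expgSE f n x : (f ^+ n.+1)%g x = f ((f ^+ n)%g x).
Proof. by rewrite expgS ietME. Qed.

Lemma expgDE f m n x : (f ^+ (m + n))%g x = (f ^+ m)%g ((f ^+ n)%g x).
Proof. by rewrite expgnDr ietME. Qed.

Lemma translates_off_sub (D E : seq R) (f : R -> R) :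
  {subset D <= E} -> translates_off D f -> translates_off E f.
Proof.
move=> DE fD x y x0 xy y1 xyE; apply: fD => // d dD; exact/xyE/DE.
Qed.

(** One finite set of breaks serves all powers below [n]; it then serves the involution built below,
    whose exponent varies from point to point. *)
Lemma expg_translates_off f n :
  exists D, forall k, (k < n)%N -> translates_off D (f ^+ k)%g.
Proof.
elim: n => [|n [D fD]]; first by exists [::].
have [_ _ [E fE]] := (is_ietP _).1 (ietP (f ^+ n)%g).
exists (D ++ E) => k; rewrite ltnS leq_eqVlt => /predU1P[->|kn].
  by apply: translates_off_sub fE => d dE; rewrite mem_cat dE orbT.
by apply: translates_off_sub (fD k kn) => d dD; rewrite mem_cat dD.
Qed.

(* A periodic map of dihedral type: if y is the least point of the orbit of x
   and y = f^a x, the involution sends x = f^(-a) y to f^a y. *)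
Lemma periodic_reversor f : periodic f ->
  exists2 i, involution i & involution (f * i)%g.
Proof.
case=> n n0 fn.
pose F k x := (f ^+ k)%g x.
have FD k l x : F (k + l)%N x = F k (F l x) by exact: expgDE.
have Fn k x : F (n * k)%N x = x by rewrite /F expgnA fn expg1n.
have Fmod k x : F (k %% n)%N x = F k x.
  by rewrite [in RHS](divn_eq k n) addnC FD mulnC Fn.
have FC k l x : F k (F l x) = F l (F k x) by rewrite -!FD addnC.
have /choice[a aP] : forall x, exists a, forall k, F a x <= F k x.
  move=> x.
  have [a _ am] := @arg_minP _ _ _ (Ordinal n0) xpredT (fun a : 'I_n => F a x) isT.
  exists a => k; rewrite -[F k x]Fmod.
  exact: (am (Ordinal (ltn_pmod k n0))).
pose i x := F (a x) (F (a x) x).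
(* Several exponents may reach the minimum of the orbit; since powers commute, each of them gives
   the same [i x]. *)
have iE x b : (forall k, F b x <= F k x) -> i x = F b (F b x).
  move=> bm; have e : F (a x) x = F b x by apply/eqP; rewrite eq_le aP bm.
  by rewrite /i e FC e.
have i_min y p z : (forall k, y <= F k y) -> F p z = y -> i z = F p y.
  move=> ym pz; rewrite (iE z p) ?pz // => k.
  by rewrite -[leRHS](Fn p) mulnC -(prednK n0) mulnSr FD (FC p) pz -FD.
have xE x : exists y p, [/\ forall k, y <= F k y, F p x = y & i x = F p y].
  exists (F (a x) x), (a x); split=> // k.
  by rewrite -FD aP.
(* The exponent [p * n.-1] stands for [- p], because [p + p * n.-1 = p * n]. *)
have Fp p y : F (p * n.-1)%N (F p y) = y.
  by rewrite -FD -mulnSr prednK // mulnC Fn.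
have i_inv x : i (i x) = x.
  have [y [p [ym px ->]]] := xE x.
  by rewrite (i_min y (p * n.-1)%N) ?Fp // -px Fp.
have fi_inv x : f (i (f (i x))) = x.
  have [y [p [ym px ->]]] := xE x.
  have fF k z : f (F k z) = F k.+1 z by rewrite /F expgSE.
  rewrite fF (i_min y (p.+1 * n.-1)%N) ?Fp // fF -px -FD.
  by rewrite addSn -addnS -mulnSr prednK // mulnC Fn.
have ii : is_iet i.
  apply/is_ietP; split.
  - apply: is_iet_bij => [|x|x]; first exact: can_inj i_inv.
      by exists (i x).
    by rewrite /i !iet_bnd.
  - by move=> x xo; rewrite /i /F !iet_out.
  have [D fD] := expg_translates_off f n.
  have {}fD k : translates_off D (F k).
    move=> x y *; rewrite -![F k _]Fmod.
    by apply: (fD _ (ltn_pmod k n0)).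
  exists D => x y x0 xy y1 xyD.
  (* With no break between [x] and [y], [F k y - F k x = y - x] for every [k], so [a x] is also a
     minimising exponent for [y]. *)
  have FE k := fD k x y x0 xy y1 xyD.
  rewrite (iE y (a x)) => [|k]; last by rewrite !FE lerD2r.
  by rewrite /i -!FD FE.
exists (mkiet ii); rewrite /involution expg2; apply: iet_ext => x /=.
  exact: i_inv.
exact: fi_inv.
Qed.

Lemma periodic_prod2 f : periodic f -> prod_involutions 2 f.
Proof.
move=> /periodic_reversor[i ii fii].
exists (fun k => if k == ord0 then f * i else i)%g => [k|]; first by case: eqP.
rewrite 2!big_ord_recl big_ord0 /= mulg1 -mulgA.
by move: ii; rewrite /involution expg2 => ->; rewrite mulg1.
Qed.

Lemma prod_involutionsM m n f g :
  prod_involutions m f -> prod_involutions n g -> prod_involutions (m + n) (f * g)%g.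
Proof.
move=> [i ii ->] [j jj ->].
exists (fun k => match fintype.split k with inl a => i a | inr b => j b end) => [k|].
  by case: (fintype.split k).
rewrite big_split_ord; congr (_ * _)%g; apply: eq_bigr => k _ /=.
- by case: split_ordP => l /eqP; rewrite ?eq_lshift ?eq_lrshift // => /eqP->.
- by case: split_ordP => l /eqP; rewrite ?eq_rshift ?eq_rlshift // => /eqP->.
Qed.

Lemma periodicV f : periodic f -> periodic f^-1%g.
Proof. by case=> n n0 fn; exists n; rewrite // expVgn fn invg1. Qed.

Lemma periodicJ f g : periodic f -> periodic (f ^ g)%g.
Proof. by case=> n n0 fn; exists n; rewrite // -conjXg fn conj1g. Qed.

(** Membership in the group [d Z]; congruences modulo [d] are expressed by applying it to
    differences. *)
Definition multiple d x : Prop := exists m : int, x = m%:~R * d.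

Lemma multiple0 d : multiple d 0.
Proof. by exists 0; rewrite mul0r. Qed.

Lemma multipleD d x y : multiple d x -> multiple d y -> multiple d (x + y).
Proof. by move=> [m ->] [n ->]; exists (m + n); rewrite intrD mulrDl. Qed.

Lemma multipleN d x : multiple d x -> multiple d (- x).
Proof. by move=> [m ->]; exists (- m); rewrite mulrNz mulNr. Qed.

Lemma multipleB d x y : multiple d x -> multiple d y -> multiple d (x - y).
Proof. by move=> hx hy; apply: multipleD => //; exact: multipleN. Qed.

Lemma multiple_trans d e x : multiple d e -> multiple e x -> multiple d x.
Proof. by move=> [m ->] [n ->]; exists (n * m); rewrite intrM mulrA. Qed.

(* Orbits stay in a coset of d Z, which meets [0, 1) in at most 1/d + 1 points. *)
Lemma multiple_periodic f d : 0 < d ->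
  (forall x, 0 <= x < 1 -> multiple d (f x - x)) -> periodic f.
Proof.
move=> d0 fd; pose M := (Num.truncn d^-1).+1.
have orbit x k : 0 <= x < 1 -> multiple d ((f ^+ k)%g x - x).
  move=> x01; elim: k => [|k IH]; first by rewrite expg0 iet1E subrr; exact: multiple0.
  have /fd := etrans (iet_bnd (f ^+ k)%g x) x01; rewrite expgSE.
  by move=> /multipleD/(_ IH); rewrite addrA subrK.
have quo y : 0 <= y < 1 ->
    (Num.truncn (y / d) < M)%N /\
    (Num.truncn (y / d))%:R * d <= y < (Num.truncn (y / d)).+1%:R * d.
  case/andP=> y0 y1; have yd : 0 <= y / d by rewrite divr_ge0 // ltW.
  have := truncn_itv yd; rewrite ler_pdivlMr // ltr_pdivrMr //.
  split=> //; rewrite truncn_lt_nat //.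
  apply: lt_trans (truncnS_gt d^-1).
  by rewrite -[ltRHS]mul1r ltr_pM2r ?invr_gt0.
(* Among the exponents [0, ..., M], two give points in the same piece of length [d]. These points
   differ by less than [d] and by a multiple of [d], so they coincide. *)
have ret x : 0 <= x < 1 -> exists2 k, (0 < k <= M)%N & (f ^+ k)%g x = x.
  move=> x01.
  have x01k k : 0 <= (f ^+ k)%g x < 1 by rewrite iet_bnd.
  have [i [j []]] := pigeonhole (fun k => Ordinal (quo _ (x01k k)).1).
  rewrite card_ord => ij jM /(congr1 val) /= eij.
  exists (j - i)%N; first by rewrite subn_gt0 ij (leq_trans (leq_subr _ _)).
  have [m mE] := orbit x i x01; have [n nE] := orbit x j x01.
  apply: (@iet_inj (f ^+ i)%g); rewrite -expgDE subnKC ?(ltnW ij) //.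
  have := (quo _ (x01k i)).2; have := (quo _ (x01k j)).2; rewrite eij.
  set q := Num.truncn _; move=> /andP[jl ju] /andP[il iu].
  suff mn : m = n by rewrite mn -nE in mE; apply: (addIr (- x)).
  have : (f ^+ i)%g x - (f ^+ j)%g x = (m - n)%:~R * d.
    by rewrite intrB mulrBl -mE -nE; ring.
  move=> e.
  have {}jl : (m - n)%:~R * d < 1%:~R * d.
    by rewrite -e mulr1z mul1r; move: jl ju il iu; rewrite -natr1; lra.
  have {}ju : (-1)%:~R * d < (m - n)%:~R * d.
    by rewrite -e mulrN1z mulN1r; move: jl ju il iu; rewrite -natr1; lra.
  by move: jl ju; rewrite !ltr_pM2r // !ltr_int; lia.
(* A common multiple of all return times, which are at most [M]. *)
exists M`!; first exact: fact_gt0.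
apply: iet_ext => x; rewrite iet1E.
have [x01|xo] := boolP (0 <= x < 1); last exact: iet_out.
have [k /andP[k0 kM] kx] := ret x x01.
have /dvdnP[q ->] : (k %| M`!)%N by rewrite dvdn_fact // k0.
rewrite mulnC expgnA; elim: q => [|q IH] //.
by rewrite expgSE IH.
Qed.

End Periodic.

(** * Rational linear forms and commensurability *)

Section Functionals.
Context {R : realType}.
Implicit Types (x y u v : R) (phi : R -> R).

Definition rat_linear phi : Prop :=
  (forall x y, phi (x + y) = phi x + phi y) /\
  (forall (q : rat) x, phi (ratr q * x) = ratr q * phi x).

(* A Q-subspace containing u which is maximal for avoiding v is a hyperplane. *)
Lemma rat_linear_separation u v : (forall q : rat, v <> ratr q * u) ->
  exists phi, [/\ rat_linear phi, phi u = 0 & phi v = 1].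
Proof.
move=> vu.
(* The condition on [u] is void for the empty set because the union of the empty chain must satisfy
   [P]; maximality then rules the empty set out. *)
pose P (A : set R) := [/\ forall (q : rat) x y, A x -> A y -> A (ratr q * x + y),
  forall x, A x -> A u & ~ A v].
have [|A [[Alin Au Av] Amax]] := @Zorn_bigcup _ P.
  move=> F FP Ftot; split.
  - move=> q x y [B FB Bx] [C FC Cy]; have [BC|CB] := Ftot _ _ FB FC.
      by exists C => //; have [lin _ _] := FP _ FC; apply: lin => //; exact: BC.
    by exists B => //; have [lin _ _] := FP _ FB; apply: lin => //; exact: CB.
  - by move=> x [B FB Bx]; exists B => //; have [_ Bu _] := FP _ FB; exact: Bu Bx.
  - by move=> [B FB Bv]; have [_ _ nBv] := FP _ FB; exact: nBv.
have {}Au : A u.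
  apply: contrapT => nAu.
  have nA x : ~ A x by move=> /Au.
  apply: (Amax [set x | exists q : rat, x = ratr q * u]).
    split; first by move=> x /nA.
    move=> /(_ u) h; apply: nAu; apply: h; exists 1.
    by rewrite rmorph1 mul1r.
  split.
  - move=> q _ _ [q1 ->] [q2 ->]; exists (q * q1 + q2).
    by rewrite rmorphD rmorphM /=; ring.
  - by move=> _ _; exists 1; rewrite rmorph1 mul1r.
  - by move=> [q /vu].
have A0 : A 0.
  by have := Alin (-1) _ _ Au Au; rewrite rmorphN1 mulN1r addNr.
have AZ (q : rat) x : A x -> A (ratr q * x) by move=> /(Alin q)/(_ A0); rewrite addr0.
have AD x y : A x -> A y -> A (x + y).
  by move=> Ax; move/(Alin 1 _ _ Ax); rewrite rmorph1 mul1r.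
have AN x : A x -> A (- x) by move/(AZ (-1)); rewrite rmorphN1 mulN1r.
have dec x : exists q : rat, A (x - ratr q * v).
  have [Ax|nAx] := pselect (A x); first by exists 0; rewrite rmorph0 mul0r subr0.
  (* Otherwise [A + Q x] would still avoid [v], against maximality. *)
  have [q Aq] : exists q : rat, A (v - ratr q * x).
    apply: contrapT => nAq.
    apply: (Amax [set y | exists q : rat, A (y - ratr q * x)]).
      split; first by move=> y Ay; exists 0; rewrite rmorph0 mul0r subr0.
      move=> /(_ x) h; apply/nAx/h; exists 1.
      by rewrite rmorph1 mul1r subrr.
    split.
    - move=> q y z [q1 h1] [q2 h2]; exists (q * q1 + q2).
      have := Alin q _ _ h1 h2; congr (A _).
      by rewrite rmorphD rmorphM /=; ring.
    - by move=> _ _; exists 0; rewrite rmorph0 mul0r subr0.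
    - exact: nAq.
  have [q0|q0] := eqVneq q 0.
    by move: Aq; rewrite q0 rmorph0 mul0r subr0.
  exists q^-1; have := AZ (- q^-1) _ Aq; congr (A _).
  have q0' : ratr q != 0 :> R by rewrite fmorph_eq0.
  by rewrite rmorphN /= fmorphV; field.
have decU x (p q : rat) : A (x - ratr p * v) -> A (x - ratr q * v) -> p = q.
  move=> Ap /AN/(AD _ _ Ap) h; apply: contrapT => /eqP pq.
  have pq0 : ratr (q - p) != 0 :> R by rewrite fmorph_eq0 subr_eq0 eq_sym.
  apply: Av; have := AZ (q - p)^-1 _ h; congr (A _).
  by move: pq0; rewrite fmorphV rmorphB /= => pq0; field.
have [c cP] := choice dec.
(* The coefficient along [v] in the direct sum of [A] and [Q v], which is all of [R]. *)
exists (fun x => ratr (c x)); split.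
- split=> [x y|q x].
    rewrite -rmorphD; congr ratr; apply: (decU (x + y)) => //.
    by have := AD _ _ (cP x) (cP y); congr (A _); rewrite rmorphD /=; ring.
  rewrite -rmorphM; congr ratr; apply: (decU (ratr q * x)) => //.
  by have := AZ q _ (cP x); congr (A _); rewrite rmorphM /=; ring.
- by rewrite (decU u (c u) 0) ?rmorph0 // mul0r subr0.
- by rewrite (decU v (c v) 1) ?rmorph1 // mul1r subrr.
Qed.

Lemma rat_linear0 phi : rat_linear phi -> phi 0 = 0.
Proof. by case=> pD _; apply: (addrI (phi 0)); rewrite -pD !addr0. Qed.

Lemma rat_linearN phi x : rat_linear phi -> phi (- x) = - phi x.
Proof.
by move=> pl; apply: (addrI (phi x)); rewrite -pl.1 !subrr rat_linear0.
Qed.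

Lemma rat_linearB phi x y : rat_linear phi -> phi (x - y) = phi x - phi y.
Proof. by move=> pl; rewrite pl.1 rat_linearN. Qed.

(** The map [(x, y) |-> phi x * y] is bilinear and balanced over the rationals, so it factors
    through the tensor product and can be evaluated on SAF. *)
Lemma G0_rat_linear (f : iet R) r (lam gam : 'I_r -> R) phi :
  exchanges f lam gam -> G0 f -> rat_linear phi ->
  \sum_k phi (lam k) * gam k = 0.
Proof.
move=> fE; rewrite /G0 /= (SAFE fE) => f0 [pD pQ].
have [|||psi psiD psiE] := @tens_lift R R (fun x y => phi x * y).
- by move=> x y z; rewrite pD mulrDl.
- by move=> x y z; rewrite mulrDr.
- by move=> q x y; rewrite pQ mulrCA mulrA.
have psi0 : psi 0 = 0 by apply: (addrI (psi 0)); rewrite -psiD !addr0.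
rewrite -[RHS]psi0 -f0 /SAF_of (big_morph psi psiD psi0).
by apply: eq_bigr => k _; rewrite psiE.
Qed.

(** The hypothesis evaluates [u (x) v - v (x) u] through each [phi]. If [v] were outside [Q u], a
    form with [phi u = 0] and [phi v = 1] would force [u = 0]. *)
Lemma commensurable_of_rat_linear u v : 0 < u ->
  (forall phi, rat_linear phi -> phi u * v - phi v * u = 0) ->
  exists2 d, 0 < d & multiple d u /\ multiple d v.
Proof.
move=> u0 uv.
have [q ->] : exists q : rat, v = ratr q * u.
  apply: contrapT => nq; have [|phi [pl pu pv]] := @rat_linear_separation u v.
    by move=> q vq; apply: nq; exists q.
  by have := uv _ pl; rewrite pu pv; lra.
have dq : 0 < (denq q)%:~R :> R by rewrite ltr0z denq_gt0.
exists (u / (denq q)%:~R); first exact: divr_gt0.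
split; first by exists (denq q); rewrite mulrC divfK ?gt_eqF.
by exists (numq q); rewrite /ratr; field; rewrite gt_eqF.
Qed.

End Functionals.

(** * Images of the exchanged intervals, and the three-interval case *)

Section ExchangedIntervals.
Context {R : realType} (f : iet R) (r : nat) (lam gam : 'I_r -> R).
Context (fE : exchanges f lam gam).

Lemma exchanges_image_bnd (k : 'I_r) :
  0 <= endpoint lam k + gam k /\ endpoint lam k + gam k + lam k <= 1.
Proof.
have [lam0 lam1 fk] := fE.
have e0 := endpoint_ge0 k lam0; have eS := endpointS lam k.
have e1 : endpoint lam k.+1 <= 1 by rewrite -lam1 -endpoint_max endpoint_le.
have lk := lam0 k.
have bnd x : endpoint lam k <= x < endpoint lam k.+1 -> 0 <= x + gam k < 1.
  move=> xk; rewrite -fk // iet_bnd; case/andP: xk => kx xk.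
  by rewrite (le_trans e0 kx) (lt_le_trans xk e1).
split.
  by have /andP[] : 0 <= endpoint lam k + gam k < 1 by apply: bnd; rewrite eS lexx ltrDl.
(* If the image went past 1, either the point sent to 1, or the left endpoint when it lands beyond
   1, would leave [[0, 1)]. *)
rewrite leNgt; apply/negP => gt1.
have [h|h] := leP (endpoint lam k) (1 - gam k).
  have /andP[] : 0 <= 1 - gam k + gam k < 1 by apply: bnd; lra.
  by lra.
have /andP[] : 0 <= endpoint lam k + gam k < 1 by apply: bnd; lra.
by lra.
Qed.

(** Overlapping images would share the larger of their left ends, whose preimages in the two
    intervals contradict injectivity. *)
Lemma exchanges_image_disjoint (j k : 'I_r) : j != k ->
  endpoint lam j + gam j + lam j <= endpoint lam k + gam k \/
  endpoint lam k + gam k + lam k <= endpoint lam j + gam j.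
Proof.
have [lam0 lam1 fk] := fE.
wlog jk : j k / (j < k)%N => [hw jk|_].
  have [/hw|kj|/val_inj e] := ltngtP j k; [exact | | by rewrite e eqxx in jk].
  by have := hw k j kj; rewrite eq_sym => /(_ jk) [] h; [right|left].
have [h1|h1] := leP (endpoint lam j + gam j + lam j) (endpoint lam k + gam k).
  by left.
have [h2|h2] := leP (endpoint lam k + gam k + lam k) (endpoint lam j + gam j).
  by right.
exfalso; pose m := Num.max (endpoint lam j + gam j) (endpoint lam k + gam k).
have eS i := endpointS lam i; have lj := lam0 j; have lk := lam0 k.
have [mj mk] : (endpoint lam j + gam j <= m /\ endpoint lam k + gam k <= m).
  by rewrite !le_max !lexx orbT.
have [mj' mk'] : (m < endpoint lam j + gam j + lam j /\ m < endpoint lam k + gam k + lam k).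
  by rewrite !gt_max h1 h2; split; rewrite ?andbT ltrDl.
have tj : f (m - gam j) = m by rewrite (fk j) ?subrK // eS; lra.
have tk : f (m - gam k) = m by rewrite (fk k) ?subrK // eS; lra.
have ejk : endpoint lam j.+1 <= endpoint lam k by exact: endpoint_le.
have : m - gam j = m - gam k by apply: (@iet_inj _ f); rewrite tj.
by move: ejk; rewrite eS; lra.
Qed.

Lemma exchanges_periodic d : 0 < d -> (forall k, multiple d (gam k)) -> periodic f.
Proof.
have [lam0 lam1 fk] := fE.
move=> d0 gd; apply: (multiple_periodic d0) => x x01.
have [|k xk] := @endpoint_find _ _ lam x; first by rewrite lam1.
by rewrite (fk k) // addrAC subrr add0r.
Qed.

End ExchangedIntervals.

Lemma riet3_periodic (R : realType) (f : iet R) : is_riet 3 f -> G0 f -> periodic f.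
Proof.
move=> [lam [gam fE]] f0.
have [lam0 lam1 _] := fE.
pose k0 : 'I_3 := ord0; pose k1 : 'I_3 := lift ord0 ord0.
pose k2 : 'I_3 := lift ord0 (lift ord0 ord0).
have e0 : endpoint lam k0 = 0 by exact: endpoint0.
have e1 : endpoint lam k1 = lam k0 by have := endpointS lam k0; rewrite e0 add0r.
have e2 : endpoint lam k2 = lam k0 + lam k1 by have := endpointS lam k1; rewrite e1.
have := exchanges_image_bnd fE k0; have := exchanges_image_bnd fE k1.
have := exchanges_image_bnd fE k2.
have := @exchanges_image_disjoint _ _ _ _ _ fE k0 k1 isT.
have := @exchanges_image_disjoint _ _ _ _ _ fE k0 k2 isT.
have := @exchanges_image_disjoint _ _ _ _ _ fE k1 k2 isT.
have := fun phi => @G0_rat_linear _ _ _ _ _ phi fE f0.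
rewrite e0 e1 e2.
have p0 := lam0 k0; have p1 := lam0 k1; have p2 := lam0 k2.
move: lam1; rewrite !big_ord_recl big_ord0 -/k0 -/k1 -/k2 addr0.
have all3 (P : 'I_3 -> Prop) : P k0 -> P k1 -> P k2 -> forall k, P k.
  move=> P0 P1 P2 [[|[|[|//]]] kP].
  - by rewrite (_ : Ordinal kP = k0) //; exact: val_inj.
  - by rewrite (_ : Ordinal kP = k1) //; exact: val_inj.
  - by rewrite (_ : Ordinal kP = k2) //; exact: val_inj.
move=> lam1 S0 d12 d02 d01 [b2 b2'] [b1 b1'] [b0 b0'].
suff [u [v [u0 uv guv]]] : exists u v, [/\ 0 < u,
    forall phi, rat_linear phi -> \sum_k phi (lam k) * gam k = phi u * v - phi v * u &
    forall k, exists m n : int, gam k = m%:~R * u + n%:~R * v].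
  have [phi pl|d d0 [du dv]] := @commensurable_of_rat_linear _ u v u0.
    by rewrite -uv //; exact: G0_rat_linear fE f0 pl.
  apply: (exchanges_periodic fE d0) => k; have [m [n ->]] := guv k.
  by apply: multipleD; [apply: multiple_trans du _; exists m
    | apply: multiple_trans dv _; exists n].
have mk u v : 0 < u ->
    (forall phi, rat_linear phi ->
       phi (lam k0) * gam k0 + phi (lam k1) * gam k1 + phi (lam k2) * gam k2
       = phi u * v - phi v * u) ->
    (forall k, exists m n : int, gam k = m%:~R * u + n%:~R * v) ->
    exists u v, [/\ 0 < u,
    forall phi, rat_linear phi -> \sum_k phi (lam k) * gam k = phi u * v - phi v * u &
    forall k, exists m n : int, gam k = m%:~R * u + n%:~R * v].
  move=> u0 uv guv; exists u, v; split=> // phi pl; rewrite -uv //.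
  by rewrite !big_ord_recl big_ord0 -/k0 -/k1 -/k2 addr0 addrA.
(* Each disjunction orders two images. The two cyclic choices are contradictory; the six others are
   the permutations of the intervals, and each determines the translations from the lengths. *)
case: d01 => d01; case: d02 => d02; case: d12 => d12; try lra.
- have [g0 g1 g2] : [/\ gam k0 = 0, gam k1 = 0 & gam k2 = 0] by split; lra.
  apply: (mk (lam k0) (lam k0)) => // [phi pl|]; first by rewrite g0 g1 g2; ring.
  by apply: all3; exists 0, 0; rewrite ?g0 ?g1 ?g2; ring.
- have [g0 g1 g2] : [/\ gam k0 = 0, gam k1 = lam k2 & gam k2 = - lam k1] by split; lra.
  apply: (mk (lam k1) (lam k2)) => // [phi pl|]; first by rewrite g0 g1 g2; ring.
  by apply: all3; rewrite ?g0 ?g1 ?g2; [exists 0, 0|exists 0, 1|exists (-1), 0]; ring.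
- have [g0 g1 g2] : [/\ gam k0 = lam k2, gam k1 = lam k2 & gam k2 = - (lam k0 + lam k1)]
    by split; lra.
  apply: (mk (lam k0 + lam k1) (lam k2)); first exact: addr_gt0.
    by move=> phi pl; rewrite g0 g1 g2 pl.1; ring.
  by apply: all3; rewrite ?g0 ?g1 ?g2; [exists 0, 1|exists 0, 1|exists (-1), 0]; ring.
- have [g0 g1 g2] : [/\ gam k0 = lam k1, gam k1 = - lam k0 & gam k2 = 0] by split; lra.
  apply: (mk (lam k0) (lam k1)) => // [phi pl|]; first by rewrite g0 g1 g2; ring.
  by apply: all3; rewrite ?g0 ?g1 ?g2; [exists 0, 1|exists (-1), 0|exists 0, 0]; ring.
- have [g0 g1 g2] : [/\ gam k0 = lam k1 + lam k2, gam k1 = - lam k0 & gam k2 = - lam k0]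
    by split; lra.
  apply: (mk (lam k0) (lam k1 + lam k2)) => // [phi pl|].
    by rewrite g0 g1 g2 pl.1; ring.
  by apply: all3; rewrite ?g0 ?g1 ?g2; [exists 0, 1|exists (-1), 0|exists (-1), 0]; ring.
- have [g0 g1 g2] : [/\ gam k0 = lam k1 + lam k2, gam k1 = lam k2 - lam k0 &
    gam k2 = - (lam k0 + lam k1)] by split; lra.
  apply: (mk (lam k0 + lam k1) (lam k1 + lam k2)); first exact: addr_gt0.
    by move=> phi pl; rewrite g0 g1 g2 !pl.1; ring.
  by apply: all3; rewrite ?g0 ?g1 ?g2; [exists 0, 1|exists (-1), 1|exists (-1), 0]; ring.
Qed.

(** * Pairs of rotations *)

Section Swap.
Context {R : realType}.
Implicit Types (a b c d l s t x y : R) (f g : iet R).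

(** The rotation of [[a, c)] by [c - b], extended by the identity; its inverse has the same form
    with break [a + c - b]. *)
Definition swapf a b c x : R :=
  if x < a then x else if x < b then x + (c - b) else
  if x < c then x - (b - a) else x.

Lemma swapfK a b c : a <= b -> b <= c ->
  cancel (swapf a b c) (swapf a (a + c - b) c).
Proof.
move=> ab bc x; rewrite /swapf.
case: (ltP x a) => xa; first by rewrite xa.
case: (ltP x b) => xb; last case: (ltP x c) => xc;
  do ?[case: ltP => ?]; lra.
Qed.

Lemma swap_iet a b c : 0 <= a -> a <= b -> b <= c -> c <= 1 ->
  exists g, g =1 swapf a b c.
Proof.
move=> a0 ab bc c1.
suff gi : is_iet (swapf a b c) by exists (mkiet gi).
have K1 := swapfK ab bc.
have K2 : cancel (swapf a (a + c - b) c) (swapf a b c).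
  have -> : swapf a b c = swapf a (a + c - (a + c - b)) c.
    by congr swapf; rewrite opprB addrC subrK.
  by apply: swapfK; lra.
apply/is_ietP; split.
- apply: is_iet_bij => [|y|x]; first exact: can_inj K1.
    by exists (swapf a (a + c - b) c y).
  rewrite /swapf; case: (ltP x a) => xa //; case: (ltP x b) => xb;
    last case: (ltP x c) => xc //; apply/idP/idP; lra.
- move=> x; rewrite /swapf; case: (ltP x a) => // xa; case: (ltP x b) => xb;
    last case: (ltP x c) => xc //; by move=> /negP[]; lra.
exists [:: a; b; c] => x y _ xy _ xyD.
have e d : d \in [:: a; b; c] -> (y < d) = (x < d).
  by move=> /xyD; rewrite negb_and -leNgt -ltNge; case: ltP; case: ltP => //=; lra.
by rewrite /swapf !e ?inE ?eqxx ?orbT //; do ?[case: ltP => ?]; ring.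
Qed.

(** [s] and [t] are the rotation amounts, which puts the breaks at [c - s] and [1 - t]; the strict
    bounds keep all four intervals nonempty. *)
Definition two_rotations f c s t : Prop :=
  [/\ 0 < s < c, 0 < t < 1 - c, c < 1 &
      forall x, f x = if x < c then swapf 0 (c - s) c x else swapf c (1 - t) 1 x].

Lemma two_rotations_exchanges f c s t : two_rotations f c s t ->
  exchanges f (fun k : 'I_4 => nth 0 [:: c - s; s; 1 - c - t; t] k)
    (fun k => nth 0 [:: s; s - c; t; t - (1 - c)] k).
Proof.
move=> [/andP[s0 sc] /andP[t0 tc] c1 fE]; split.
- by move=> [[|[|[|[|//]]]] k4] /=; lra.
- by rewrite !big_ord_recl big_ord0 /=; ring.
have e n : (n <= 4)%N ->
    endpoint (fun k : 'I_4 => nth 0 [:: c - s; s; 1 - c - t; t] k) n =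
    nth 0 [:: 0; c - s; c; 1 - t; 1] n.
  case: n => [|[|[|[|[|//]]]]] _; rewrite /endpoint big_mkcond;
    by rewrite !big_ord_recl big_ord0 /=; ring.
move=> k x; rewrite !e // ?(ltnW (ltn_ord k)) // fE /swapf.
by case: k => [[|[|[|[|//]]]] k4] /= xk; do ?[case: ltP => ?]; lra.
Qed.

Lemma tensBl x y z : tens (x - y) z = tens x z - tens y z.
Proof. by apply/eqP; rewrite eq_sym subr_eq -tensDl subrK. Qed.

Lemma tensBr x y z : tens x (y - z) = tens x y - tens x z.
Proof. by apply/eqP; rewrite eq_sym subr_eq -tensDr subrK. Qed.

(** Rotating a length [c] by [s] contributes [(c - s) (x) s + s (x) (s - c) = c (x) s - s (x) c],
    and a rational [c] moves across the tensor sign. *)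
Lemma SAF_two_rotations f (q : rat) s t : two_rotations f (ratr q) s t ->
  let u := ratr q * s + ratr (1 - q) * t in
  SAF f = tens 1 u - tens u 1.
Proof.
move=> /two_rotations_exchanges/SAFE-> u.
rewrite /SAF_of !big_ord_recl big_ord0 /= addr0.
have -> : 1 - ratr q = ratr (1 - q) :> R by rewrite rmorphB rmorph1.
have qT p x : tens (ratr p) x = tens 1 (ratr p * x) by rewrite -tensQ mulr1.
have Tq p x : tens x (ratr p) = tens (ratr p * x) 1 by rewrite tensQ mulr1.
rewrite !tensBl !tensBr !Tq !qT /u tensDr tensDl.
set A := tens s s; set B := tens 1 _; set C := tens _ 1.
set D := tens 1 _; set E := tens _ 1; set F := tens t t.
by rewrite subrKA addrA subrKA opprD addrACA.
Qed.

(** If [u = q s + (1 - q) t] were irrational, some form would satisfy [phi 1 = 0] and [phi u = 1];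
    but evaluating SAF through a form that kills the rationals gives [- phi u]. *)
Lemma two_rotations_G0 f (q : rat) s t : two_rotations f (ratr q) s t -> G0 f ->
  exists p : rat, ratr q * s + ratr (1 - q) * t = ratr p.
Proof.
move=> fr f0; apply: contrapT => np.
have [|phi [pl p1 pu]] := @rat_linear_separation _ 1 (ratr q * s + ratr (1 - q) * t).
  by move=> p; rewrite mulr1 => pE; apply: np; exists p.
have := G0_rat_linear (two_rotations_exchanges fr) f0 pl.
rewrite !big_ord_recl big_ord0 /= !(rat_linearB _ _ pl) p1.
have := pl.2 q 1; rewrite mulr1 p1 mulr0 => ->.
by move: pu; rewrite pl.1 !pl.2 rmorphB rmorph1; lra.
Qed.

Lemma two_rotations_left f c s t x : two_rotations f c s t -> 0 <= x < c ->
  0 <= f x < c /\ multiple c (f x - x - s).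
Proof.
move=> [/andP[s0 sc] /andP[t0 tc] c1 fE] /andP[x0 xc].
rewrite fE xc /swapf ltNge x0 /= xc; have [h|h] := ltP x (c - s).
  by split; [lra | exists 0; ring].
by split; [lra | exists (-1); ring].
Qed.

Lemma two_rotations_right f c s t x : two_rotations f c s t -> c <= x < 1 ->
  c <= f x < 1 /\ multiple (1 - c) (f x - x - t).
Proof.
move=> [/andP[s0 sc] /andP[t0 tc] c1 fE] /andP[cx x1].
rewrite fE ltNge cx /= /swapf ltNge cx /= x1; have [h|h] := ltP x (1 - t).
  by split; [lra | exists 0; ring].
by split; [lra | exists (-1); ring].
Qed.

Lemma restricted_rotation_swap f a b : restricted_rotation f a b ->
  [/\ 0 <= a, b <= 1 & exists2 s, 0 < s < b - a & f =1 swapf a (b - s) b].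
Proof.
move=> [ab fs [r [lam [gam rE]] fr]].
have supp x : (f x != x) = (a <= x < b).
  have : Defs.support f x <-> `[a, b[%classic x by rewrite fs.
  by rewrite /Defs.support /= in_itv /= => h; apply/idP/idP => /h.
have in01 x : a <= x < b -> 0 <= x < 1.
  by rewrite -supp; apply: contraR => /iet_out->.
have a0 : 0 <= a by have /andP[] := in01 a ltac:(by rewrite lexx).
have b1 : b <= 1.
  rewrite leNgt; apply/negP => b1.
  (* Otherwise [Num.max a 1] would be a moved point outside [[0, 1)]. *)
  have : 0 <= Num.max a 1 < 1 by apply: in01; rewrite le_max lexx gt_max ab b1.
  by rewrite gt_max ltxx !andbF.
split=> //.
pose k0 : 'I_2 := ord0; pose k1 : 'I_2 := lift ord0 ord0.
have e0 : endpoint lam k0 = 0 by exact: endpoint0.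
have e1 : endpoint lam k1 = lam k0 by have := endpointS lam k0; rewrite e0 add0r.
have := exchanges_image_bnd rE k0; have := exchanges_image_bnd rE k1.
have := @exchanges_image_disjoint _ _ _ _ _ rE k0 k1 isT.
have [lam0 lam1 tk] := rE; have p0 := lam0 k0; have p1 := lam0 k1.
have t0 := tk k0; have t1 := tk k1.
rewrite !endpointS in t0 t1; rewrite e0 add0r in t0; rewrite e1 e0 add0r in t1.
rewrite e0 e1.
move: lam1; rewrite !big_ord_recl big_ord0 -/k0 -/k1 addr0 => lam1.
rewrite lam1 in t1.
have ba : 0 < b - a by rewrite subr_gt0.
have fx x : a <= x < b -> f x = a + (b - a) * r ((x - a) / (b - a)).
  by move=> xab; rewrite fr //; field; rewrite gt_eqF.
(* Either the two images keep their order, and then [a] is fixed although it lies in the support, or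
   they are swapped. *)
move=> [d [h1 h1'] [h0 h0']|d [h1 h1'] [h0 h0']].
  have g0 : gam k0 = 0 by lra.
  have : f a != a by rewrite supp lexx.
  by rewrite fx ?lexx // subrr mul0r t0 ?lexx // g0 !addr0 mulr0 addr0 eqxx.
have [g0 g1] : gam k0 = 1 - lam k0 /\ gam k1 = - lam k0 by split; lra.
(* [1 - lam k0] is the translation of the first interval of the 2-IET, here rescaled to length
   [b - a]. *)
exists ((b - a) * (1 - lam k0)).
  by rewrite mulr_gt0 ?gtr_pMr //; lra.
have bE : b - (b - a) * (1 - lam k0) = a + (b - a) * lam k0 by ring.
move=> x; rewrite /swapf.
have [xa|ax] := ltP x a.
  by apply/eqP; rewrite -[_ == _]negbK supp leNgt xa.
have [xb|bx] := ltP x b; last first.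
  case: ltP => [h|_]; last by apply/eqP; rewrite -[_ == _]negbK supp (ltNge x) bx andbF.
  have : 0 < (b - a) * (1 - lam k0) by rewrite mulr_gt0 //; lra.
  by lra.
have xab : a <= x < b by rewrite ax.
have u0 : 0 <= (x - a) / (b - a) by rewrite divr_ge0 ?subr_ge0 // ltW.
have u1 : (x - a) / (b - a) < 1 by rewrite ltr_pdivrMr // mul1r; lra.
rewrite fx //; case: ltP => h.
  rewrite t0; first by rewrite g0; field; rewrite gt_eqF.
  by rewrite u0 ltr_pdivrMr //; lra.
rewrite t1; first by rewrite g1; field; rewrite gt_eqF.
by rewrite u1 andbT ler_pdivlMr //; lra.
Qed.

(** The supports are disjoint, so both products are the same map; both orders are recorded because
    either factor may carry the left interval. *)
Lemma two_rotations_mul f g c s t : 0 < s < c -> 0 < t < 1 - c ->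
  f =1 swapf 0 (c - s) c -> g =1 swapf c (1 - t) 1 ->
  two_rotations (f * g)%g c s t /\ two_rotations (g * f)%g c s t.
Proof.
move=> hs ht fE gE; have c1 : c < 1 by lra.
have lo x : x < c -> swapf 0 (c - s) c x < c /\ swapf c (1 - t) 1 x = x.
  move=> xc; rewrite /swapf xc; split => //.
  by case: (ltP x 0) => ?; [|case: (ltP x (c - s)) => ?]; lra.
have hi x : c <= x -> c <= swapf c (1 - t) 1 x /\ swapf 0 (c - s) c x = x.
  move=> cx; rewrite /swapf; split; last by do ?[case: ltP => ?]; lra.
  by case: (ltP x c) => ?; [|case: (ltP x (1 - t)) => ?; [|case: (ltP x 1) => ?]]; lra.
split; split=> // x; rewrite ietME fE gE; case: ltP => xc.
- by rewrite (lo x xc).2.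
- by rewrite (hi _ (hi x xc).1).2.
- by rewrite (lo _ (lo x xc).1).2.
- by rewrite (hi x xc).2.
Qed.

End Swap.

(** * Displacements modulo a rational cell length *)

Section Cells.
Context {R : realType} (N : nat) (N0 : (0 < N)%N).
Implicit Types (f g : iet R) (x y : R) (v w : nat -> R).

Let l : R := N%:R^-1.
Let l0 : 0 < l. Proof. by rewrite invr_gt0 ltr0n. Qed.
Let Nl : N%:R * l = 1. Proof. by rewrite /l mulfV // pnatr_eq0 -lt0n. Qed.

Definition cell j x : bool := j%:R * N%:R^-1 <= x < j.+1%:R * N%:R^-1.

Lemma cell_lt j x : (j < N)%N -> cell j x -> 0 <= x < 1.
Proof.
move=> jN /andP[jx xj]; apply/andP; split.
  by apply: le_trans jx; rewrite mulr_ge0 ?ler0n // ltW.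
by apply: lt_le_trans xj _; rewrite -[leRHS]Nl ler_pM2r // ler_nat.
Qed.

Lemma cell_exists x : 0 <= x < 1 -> exists2 j, (j < N)%N & cell j x.
Proof.
case/andP=> x0 x1; have y0 : 0 <= x * N%:R by rewrite mulr_ge0.
exists (Num.truncn (x * N%:R)).
  by rewrite truncn_lt_nat // gtr_pMl // ltr0n.
rewrite /cell ler_pdivrMr ?ltr0n // ltr_pdivlMr ?ltr0n //.
exact: truncn_itv.
Qed.

Lemma cell_rotation w : exists g, forall j x, (j < N)%N -> cell j x ->
  cell j (g x) /\ multiple l (g x - x - w j).
Proof.
suff [g [gc _]] : exists g,
    (forall j x, (j < N)%N -> cell j x ->
       cell j (g x) /\ multiple l (g x - x - w j)) /\
    (forall x, N%:R * l <= x -> g x = x) by exists g.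
(* Induction on the number of cells already rotated; being the identity beyond them keeps the next
   rotation from interfering. *)
suff H k : (k <= N)%N -> exists g,
    (forall j x, (j < k)%N -> cell j x ->
       cell j (g x) /\ multiple l (g x - x - w j)) /\
    (forall x, k%:R * l <= x -> g x = x) by exact: H.
elim: k => [|k IH] kN; first by exists 1%g.
have [g [gc gid]] := IH (ltnW kN).
(* [th] represents [w k] modulo [l] in [[0, l)]; the value 0 is possible and gives a degenerate
   swap. *)
pose m := Num.floor (w k / l); pose th := w k - m%:~R * l.
have [th0 thl] : 0 <= th /\ th < l.
  have := floor_itv (w k / l); rewrite -/m => /andP[].
  rewrite ler_pdivlMr // ltr_pdivrMr // intrD mulrDl mul1r /th; lra.
have kl : 0 <= k%:R * l by rewrite mulr_ge0 // ltW.
have Sk : k.+1%:R * l = k%:R * l + l by rewrite -natr1 mulrDl mul1r.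
have kN1 : k.+1%:R * l <= 1 by rewrite -[leRHS]Nl ler_pM2r // ler_nat.
have [||||r rE] := @swap_iet _ (k%:R * l) (k.+1%:R * l - th) (k.+1%:R * l); try lra.
exists (r * g)%g; split=> [j x|x xk]; last first.
  rewrite ietME gid; last by lra.
  by rewrite rE /swapf; do ?[case: ltP => ?]; lra.
rewrite ltnS leq_eqVlt => /predU1P[->|jk] xj; last first.
  have [gj gm] := gc j x jk xj; suff -> : (r * g)%g x = g x by [].
  rewrite ietME rE /swapf; case: ltP => // h; exfalso.
  have : j.+1%:R * l <= k%:R * l by rewrite ler_pM2r // ler_nat.
  by move: gj; rewrite /cell -/l => /andP[_]; lra.
move: xj; rewrite /cell -/l => /andP[kx xk].
rewrite ietME gid // rE /swapf ltNge kx /= xk.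
have wE : w k = th + m%:~R * l by rewrite /th subrK.
case: ltP => h.
  split; [lra | exists (- m); rewrite wE Sk mulrNz; ring].
split; [lra | exists (- 1 - m); rewrite wE Sk intrB mulrN1z; ring].
Qed.

Lemma cell_shift : exists g,
  forall x, 0 <= x < 1 -> g x = if x < 1 - l then x + l else x + l - 1.
Proof.
have l1 : l <= 1 by rewrite -[leRHS]Nl ler_peMl ?ler1n // ltW.
have [||||g gE] := @swap_iet R 0 (1 - l) 1; rewrite ?subr_ge0 // ?gerBl ?(ltW l0) //.
exists g => x /andP[x0 x1]; rewrite gE /swapf ltNge x0 /= x1.
by case: ltP; lra.
Qed.

(* If w j = v 0 + ... + v j, then f and the commutator of w with the shift have
   displacements that cancel modulo the cell length. *)
Lemma cells_prod6 f v (q : rat) :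
  (forall j x, (j < N)%N -> cell j x -> multiple l (f x - x - v j)) ->
  \sum_(j < N) v j = ratr q -> prod_involutions 6 f.
Proof.
move=> fv vq.
pose w j := \sum_(i < j.+1) v i.
have [g gP] := cell_rotation w; have [c cE] := cell_shift.
have l1 : multiple l 1 by exists N; rewrite -pmulrn Nl.
have ll : multiple l l by exists 1; rewrite mul1r.
(* Chosen so that both [l] and the rational [q] are multiples of [d]; for [q] this uses
   [N * l = 1]. *)
pose d : R := l / (denq q)%:~R.
have d0 : 0 < d by rewrite divr_gt0 // ltr0z denq_gt0.
have dq : (denq q)%:~R != 0 :> R by rewrite intr_eq0 denq_eq0.
have dl : multiple d l by exists (denq q); rewrite /d mulrC divfK.
have dqq : multiple d (ratr q).
  exists (numq q * N); rewrite intrM -[N%:~R]/(N%:R) -mulrA [N%:R * d]mulrA Nl.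
  by rewrite mul1r.
have shift j x : (j < N)%N -> cell j x -> [/\ multiple l (c x - x),
    (j.+1 < N)%N -> cell j.+1 (c x) & j.+1 = N -> cell 0 (c x)].
  move=> jN xj; rewrite cE; last exact: cell_lt xj.
  have Sj : j.+1%:R * l = j%:R * l + l by rewrite -natr1 mulrDl mul1r.
  have SSj : j.+2%:R * l = j.+1%:R * l + l by rewrite -natr1 mulrDl mul1r.
  move: xj; rewrite /cell -/l => /andP[jx xj].
  split.
  - case: ifP => _; first by rewrite addrAC subrr add0r.
    have -> : x + l - 1 - x = l - 1 by ring.
    exact: multipleB.
  - move=> SjN; have : j.+2%:R * l <= 1 by rewrite -[leRHS]Nl ler_pM2r // ler_nat.
    by move=> h; rewrite ifT; lra.
  - move=> jE; move: Nl; rewrite -jE => j1.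
    by rewrite ifF; [rewrite mul0r mul1r; lra | apply/negbTE; rewrite -leNgt; lra].
have gshift j x : (j < N)%N -> cell j x -> cell j (g x) by move=> jN /(gP _ _ jN)[].
have per_c : periodic c.
  apply: (multiple_periodic l0) => x /cell_exists[j jN xj].
  by have [] := shift j x jN xj.
(* Modulo [d] the shift does not count: one path from [x] collects [w j] and then [v k], the other
   collects [w k]. *)
have key j k x : (j < N)%N -> (k < N)%N -> cell j x -> cell k (c x) -> cell k (c (g x)) ->
    multiple d (v k + w j - w k) -> multiple d (f (c (g x)) - g (c x)).
  move=> jN kN xj cxk cgk vw.
  have [_ gx] := gP _ _ jN xj; have [_ gcx] := gP _ _ kN cxk.
  have fcg := fv _ _ kN cgk.
  have [cx _ _] := shift _ _ jN xj; have [cgx _ _] := shift _ _ jN (gshift _ _ jN xj).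
  have -> : f (c (g x)) - g (c x) = (v k + w j - w k) +
    ((f (c (g x)) - c (g x) - v k) + (c (g x) - g x) + (g x - x - w j)
     - (c x - x) - (g (c x) - c x - w k)) by ring.
  apply: multipleD => //; apply: multiple_trans dl _.
  apply: multipleB => //; apply: multipleB => //.
  by apply: multipleD => //; exact: multipleD.
(* This map is [(f c g) (g c)^-1], so its displacement at [g (c x)] is the difference treated in
   [key]. *)
have per_a : periodic (f * c * g * c^-1 * g^-1)%g.
  apply: (multiple_periodic d0) => y y01.
  have [x yE] : exists x, y = g (c x).
    by exists ((c^-1)%g ((g^-1)%g y)); rewrite !ietKV.
  have x01 : 0 <= x < 1 by rewrite -(iet_bnd c) -(iet_bnd g) -yE.
  rewrite yE !ietME ietVK ietVK.
  have [j jN xj] := cell_exists x01.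
  have [_ cx cx0] := shift _ _ jN xj.
  have [_ cgx cgx0] := shift _ _ jN (gshift _ _ jN xj).
  have [jN'|] := ltnP j.+1 N.
    apply: (key j j.+1) => //; [exact: cx|exact: cgx|].
    have -> : w j.+1 = w j + v j.+1 by rewrite /w big_ord_recr.
    by rewrite [v _ + _]addrC subrr; exact: multiple0.
  (* The last cell is shifted onto cell 0, and there [v 0 + w j - w 0] is the full sum of [v], that
     is [q]. *)
  move=> Nj; have jE : j.+1 = N by apply/eqP; rewrite eqn_leq jN.
  apply: (key j 0%N) => //; [exact: cx0|exact: cgx0|].
  rewrite /w jE vq big_ord_recl big_ord0 addr0 addrAC subrr add0r.
  exact: dqq.
have -> : f = ((f * c * g * c^-1 * g^-1) * (c ^ g^-1) * c^-1)%g.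
  by rewrite conjgE invgK !mulgA !mulgVK !mulgK.
rewrite -[6%N]/(2 + 2 + 2)%N.
apply: prod_involutionsM; first apply: prod_involutionsM; apply: periodic_prod2 => //.
  exact: periodicJ.
exact: periodicV.
Qed.

End Cells.

(** * Irreversible four-interval exchanges *)

Section NotReversible.
Context {R : realType}.
Implicit Types (f h : iet R) (l s t x : R).

Lemma orbit_displacement f (P : R -> bool) l s :
  (forall x, P x -> P (f x) /\ multiple l (f x - x - s)) ->
  forall n x, P x -> P ((f ^+ n)%g x) /\ multiple l ((f ^+ n)%g x - x - n%:R * s).
Proof.
move=> fP n x Px; elim: n => [|n [Pn mn]].
  by rewrite expg0 iet1E subrr mul0r subrr; split=> //; exact: multiple0.
rewrite expgSE; have [PS mS] := fP _ Pn; split=> //.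
have := multipleD mS mn; congr multiple; rewrite -natr1; ring.
Qed.

(* The displacement of h takes finitely many values, so it takes the same value
   at f^i x and f^j x for some i < j, while h (f^n x) = f^(-n) (h x). *)
Lemma reversor_displacement f h x l s e : (f * h * f = h)%g -> 0 <= x < 1 ->
  (forall n, multiple l ((f ^+ n)%g x - x - n%:R * s)) ->
  (forall n z, (f ^+ n)%g z = h x -> multiple l (h x - z - n%:R * e)) ->
  exists2 k, (0 < k)%N & multiple l (k%:R * (s + e)).
Proof.
move=> fhf x01 xs he.
have fhfn n : (f ^+ n * h * f ^+ n = h)%g.
  elim: n => [|n IH]; first by rewrite expg0 mulg1 mul1g.
  by rewrite [in X in (_ * X)%g]expgS expgSr -!mulgA [(f * (h * _))%g]mulgA
    [(f * h * _)%g]mulgA fhf mulgA.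
have [_ _ [r [lam [gam [lam0 lam1 hE]]]]] := ietP h.
have /choice[k kP] : forall n, exists k, h ((f ^+ n)%g x) = (f ^+ n)%g x + gam k.
  move=> n; have [|k xk] := @endpoint_find _ _ lam ((f ^+ n)%g x).
    by rewrite lam1 iet_bnd.
  by exists k; exact: hE xk.
have [i [j [ij _ kij]]] := pigeonhole k.
have hx n : (f ^+ n)%g (h ((f ^+ n)%g x)) = h x by rewrite -!ietME fhfn.
exists (j - i)%N; first by rewrite subn_gt0.
(* For each of the two exponents [n], the sum of the two congruences reads
   [h x - x - gam (k n) - n (s + e)]; equal values of [gam] cancel in the difference. *)
have := multipleB (multipleD (xs i) (he _ _ (hx i))) (multipleD (xs j) (he _ _ (hx j))).
by rewrite !kP kij natrB ?(ltnW ij) //; congr multiple; ring.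
Qed.

(** Both lengths are multiples of [l], so orbits in either invariant piece advance by a constant
    modulo [l]. The orbit of 0 advances by [s], that of [h 0] by [s] or [t] according to the piece
    containing it. *)
Lemma two_rotations_irreversible f c s t l : two_rotations f c s t ->
  multiple l c -> multiple l (1 - c) ->
  (forall k, (0 < k)%N -> ~ multiple l (k%:R * (s + s))) ->
  (forall k, (0 < k)%N -> ~ multiple l (k%:R * (s + t))) -> ~ reversible f.
Proof.
move=> fr lc lc1 ss st [h hf].
have fhf : (f * h * f = h)%g.
  by rewrite -mulgA; apply: (mulgI f^-1%g); rewrite mulKg -[in RHS]hf mulgVK.
have left := @orbit_displacement f (fun x => 0 <= x < c) l s.
have right := @orbit_displacement f (fun x => c <= x < 1) l t.
have {}left n x : 0 <= x < c ->
    0 <= (f ^+ n)%g x < c /\ multiple l ((f ^+ n)%g x - x - n%:R * s).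
  apply: left => {}x /(two_rotations_left fr)[? m]; split=> //.
  exact: multiple_trans lc m.
have {}right n x : c <= x < 1 ->
    c <= (f ^+ n)%g x < 1 /\ multiple l ((f ^+ n)%g x - x - n%:R * t).
  apply: right => {}x /(two_rotations_right fr)[? m]; split=> //.
  exact: multiple_trans lc1 m.
have c0 : 0 < c by case: fr => /andP[]; lra.
have x0 : 0 <= (0 : R) < c by rewrite lexx.
have x01 : 0 <= (0 : R) < 1 by rewrite lexx ltr01.
have zh n z : (f ^+ n)%g z = h 0 -> 0 <= z < 1.
  by move=> zE; rewrite -(iet_bnd (f ^+ n)%g) zE iet_bnd.
have [hc|hc] := ltP (h 0) c.
  have [n z nz|k k0 /(ss k k0)//] :=
    @reversor_displacement f h 0 l s s fhf x01 (fun n => (left n 0 x0).2).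
  have /andP[z0 z1] := zh _ _ nz; have [zc|cz] := ltP z c.
    by have [|_] := left n z; rewrite ?nz // z0.
  have [|] := right n z; first by rewrite cz.
  by rewrite nz leNgt hc.
have [n z nz|k k0 /(st k k0)//] :=
  @reversor_displacement f h 0 l s t fhf x01 (fun n => (left n 0 x0).2).
have /andP[z0 z1] := zh _ _ nz; have [zc|cz] := ltP z c.
  have [|] := left n z; first by rewrite z0.
  by rewrite nz [_ < c]ltNge hc andbF.
by have [|_] := right n z; rewrite ?nz // cz.
Qed.

(** In [numq q ^+ 2 = 2 * denq q ^+ 2] the exponent of 2 is even on the left and odd on the
    right. *)
Lemma sqrt2_irrational (q : rat) : Num.sqrt 2 <> ratr q :> R.
Proof.
move=> qE; have q2 : q ^+ 2 = 2.
  have : ratr (q ^+ 2) = ratr 2 :> R by rewrite rmorphXn /= -qE sqr_sqrtr // rmorph_nat.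
  exact: fmorph_inj.
have : numq q ^+ 2 = 2 * denq q ^+ 2.
  apply: (@intr_inj rat); rewrite rmorphXn [RHS]rmorphM /= rmorphXn /= [X in X ^+ 2 = _]numqE.
  by rewrite exprMn q2.
move/(congr1 absz); rewrite abszM !abszX => e.
have d0 : (0 < `|denq q|)%N by rewrite absz_gt0 denq_eq0.
have n0 : (0 < `|numq q|)%N.
  by rewrite absz_gt0 numq_eq0; apply/eqP => q0; move: q2; rewrite q0 expr0n.
move/(congr1 (logn 2)): e; rewrite lognM ?expn_gt0 ?d0 // !lognX.
rewrite (_ : logn 2 `|2%Z| = 1%N) //; lia.
Qed.

Lemma exists_irreversible_4iet :
  exists f : iet R, [/\ is_riet 4 f, G0 f & ~ reversible f].
Proof.
(* With [t = 1 - 2 s], the bounds [1/3 < s < 1/2] are what [0 < t < 1/3] demands;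
   [(2/3) s + (1/3) t = 1/3], while [s + s] and [s + t = 1 - s] are irrational. *)
pose s : R := Num.sqrt 2 - 1; pose c : R := ratr (2 / 3).
have cE : c = 2 / 3 by rewrite /c rmorphM /= fmorphV !rmorph_nat.
have s1 : 1 / 3 < s < 1 / 2.
  have r0 : 0 <= Num.sqrt 2 :> R by exact: sqrtr_ge0.
  have r2 : Num.sqrt 2 ^+ 2 = 2 :> R by rewrite sqr_sqrtr ?ler0n.
  by rewrite /s; apply/andP; split; nra.
have sq (q : rat) : s <> ratr q.
  move=> sE; apply: (@sqrt2_irrational (q + 1)).
  by rewrite rmorphD rmorph1 /= -sE /s subrK.
have [||||f fE] := @swap_iet R 0 (c - s) c; try lra.
have [||||g gE] := @swap_iet R c (1 - (1 - 2 * s)) 1; try lra.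
have [||fgr _] := @two_rotations_mul _ f g c s (1 - 2 * s) _ _ fE gE; try lra.
have multiple_rat (k : nat) (x : R) : multiple (1 / 3) (k%:R * x) -> (0 < k)%N ->
    exists q : rat, x = ratr q.
  move=> [m mE] k0; exists (m%:~R / (3 * k%:R)).
  have k0' : k%:R != 0 :> R by rewrite pnatr_eq0 -lt0n.
  rewrite rmorphM /= fmorphV rmorphM /= !rmorph_nat rmorph_int.
  by apply: (mulfI k0'); rewrite mE; field.
exists (f * g)%g; split.
- by exists (fun k => nth 0 [:: c - s; s; 1 - c - (1 - 2 * s); 1 - 2 * s] k),
    (fun k => nth 0 [:: s; s - c; 1 - 2 * s; (1 - 2 * s) - (1 - c)] k);
    exact: two_rotations_exchanges.
- rewrite /G0 /= (SAF_two_rotations fgr) /=.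
  have -> : ratr (2 / 3) * s + ratr (1 - 2 / 3) * (1 - 2 * s) = ratr (1 - 2 / 3) * 1 :> R.
    rewrite (_ : ratr (1 - 2 / 3) = 1 - c); last by rewrite rmorphB rmorph1.
    by rewrite -/c cE; field.
  by rewrite tensQ subrr.
apply: (@two_rotations_irreversible _ c s (1 - 2 * s) (1 / 3)) => //.
- by exists 2; rewrite cE; field.
- by exists 1; rewrite cE; field.
- move=> k k0 /multiple_rat/(_ k0)[q qE]; apply: (sq (q / 2)).
  by rewrite rmorphM /= fmorphV rmorph_nat /= -qE; field.
- move=> k k0 /multiple_rat/(_ k0)[q qE]; apply: (sq (1 - q)).
  by rewrite rmorphB rmorph1 /= -qE; ring.
Qed.

End NotReversible.

(** * Rotations of two complementary intervals as six involutions *)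

Section SixInvolutions.
Context {R : realType}.
Implicit Types f g : iet R.

(** Both lengths are multiples of [1/N], so modulo [1/N] the first [m] cells move by [s] and the
    others by [t]. The total [m s + (N - m) t] is rational by the SAF condition. *)
Lemma two_rotations_prod6 f (m N : nat) s t : (m <= N)%N -> (0 < N)%N ->
  two_rotations f (m%:R / N%:R) s t -> G0 f -> prod_involutions 6 f.
Proof.
move=> mN N0 fr f0.
have qE : m%:R / N%:R = ratr (m%:R / N%:R) :> R.
  by rewrite rmorphM /= fmorphV !rmorph_nat.
have [p pE] : exists p : rat, ratr (m%:R / N%:R) * s + ratr (1 - m%:R / N%:R) * t = ratr p.
  by apply: (@two_rotations_G0 _ f) => //; rewrite -qE.
have N0' : N%:R != 0 :> R by rewrite pnatr_eq0 -lt0n.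
pose v j := if (j < m)%N then s else t.
have vE : \sum_(j < N) v j = ratr (N%:R * p).
  have -> : ratr (N%:R * p) = N%:R * ratr p :> R by rewrite rmorphM rmorph_nat.
  rewrite -pE rmorphB rmorph1 /= -qE.
  rewrite -(big_mkord xpredT v) (big_cat_nat _ mN) //=.
  rewrite (@eq_big_nat _ _ _ 0 m v (fun=> s)); last by move=> j /andP[_ jm]; rewrite /v jm.
  rewrite (@eq_big_nat _ _ _ m N v (fun=> t)); last first.
    by move=> j /andP[mj _]; rewrite /v ltnNge mj.
  rewrite !sumr_const_nat subn0 -[s *+ _]mulr_natl -[t *+ _]mulr_natl natrB //.
  by field.
apply: (cells_prod6 N0 _ vE) => j x jN xj; have /andP[x0 x1] := cell_lt N0 jN xj.
move: xj; rewrite /cell /v => /andP[jx xj].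
have Ni0 : 0 <= N%:R^-1 :> R by rewrite invr_ge0.
case: ltnP => [jm|mj].
  have [|_] := two_rotations_left fr (x := x).
    by rewrite x0 (lt_le_trans xj) // ler_wpM2r // ler_nat.
  by apply: multiple_trans; exists m.
have [|_] := two_rotations_right fr (x := x).
  by rewrite x1 (le_trans _ jx) // ler_wpM2r // ler_nat.
by apply: multiple_trans; exists (N%:Z - m%:Z); rewrite intrB -!pmulrn; field.
Qed.

(** Testing the equality of sets at 0 and at the endpoints is enough to locate both intervals. *)
Lemma itv_complement (a1 b1 a2 b2 : R) : 0 <= a1 -> a1 < b1 -> b1 <= 1 ->
  0 <= a2 -> a2 < b2 -> b2 <= 1 ->
  `[a2, b2[%classic = `[0, 1[%classic `\` `[a1, b1[%classic ->
  [/\ a1 = 0, b1 = a2 & b2 = 1] \/ [/\ a2 = 0, b2 = a1 & b1 = 1].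
Proof.
move=> a10 ab1 b11 a20 ab2 b21 e.
have H x : a2 <= x < b2 <-> 0 <= x < 1 /\ ~ (a1 <= x < b1).
  have : `[a2, b2[%classic x <-> (`[0, 1[%classic `\` `[a1, b1[%classic) x by rewrite e.
  by rewrite /setD /= !in_itv.
have i1 x : a2 <= x -> x < b2 -> a1 <= x -> x < b1 -> False.
  by move=> h1 h2 h3 h4; have [_] := (H x).1 (introT andP (conj h1 h2)); apply; rewrite h3.
have i2 x : 0 <= x -> x < 1 -> x < a1 \/ b1 <= x -> a2 <= x /\ x < b2.
  move=> h1 h2 h3; apply/andP/H; split; first by rewrite h1.
  by move=> /andP[h4 h5]; case: h3; lra.
have [a1E|a1E] := eqVneq a1 0.
  left; have b1a2 : b1 <= a2.
    by rewrite leNgt; apply/negP => h; apply: (i1 a2) => //; rewrite a1E.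
  have [a2b1 _] : a2 <= b1 /\ b1 < b2 by apply: i2; [lra|lra|right].
  split=> //; first by lra.
  apply/eqP; rewrite eq_le b21 leNgt; apply/negP => h.
  have [] : a2 <= b2 /\ b2 < b2 by apply: i2; [lra|lra|right; lra].
  by lra.
have a1p : 0 < a1 by rewrite lt_neqAle eq_sym a1E.
right; have [a2E _] : a2 <= 0 /\ 0 < b2 by apply: i2; [|exact: ltr01|left].
have b2a1 : b2 <= a1.
  by rewrite leNgt; apply/negP => h; apply: (i1 a1) => //; lra.
have a1b2 : a1 <= b2.
  rewrite leNgt; apply/negP => h.
  have [] : a2 <= b2 /\ b2 < b2 by apply: i2; [lra|lra|left].
  by lra.
split; [lra|lra|]; apply/eqP; rewrite eq_le b11 leNgt; apply/negP => h.
have [] : a2 <= b1 /\ b1 < b2 by apply: i2; [lra|lra|right].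
by lra.
Qed.

Lemma restricted_rotations_prod6 f g1 g2 (a1 b1 a2 b2 : R) (p : nat) :
  G0 f -> f = (g1 * g2)%g ->
  restricted_rotation g1 a1 b1 -> restricted_rotation g2 a2 b2 ->
  `[a2, b2[%classic = `[0, 1[%classic `\` `[a1, b1[%classic ->
  b1 - a1 = p%:R / p.+1%:R -> prod_involutions 6 f.
Proof.
move=> f0 fE r1 r2 e pE.
have [ab1 _ _] := r1; have [ab2 _ _] := r2.
have [a10 b11 [s sb sE]] := restricted_rotation_swap r1.
have [a20 b21 [t tb tE]] := restricted_rotation_swap r2.
(* When the interval of length [p/(p+1)] is on the right, the left one has length [1/(p+1)], hence
   [m = 1] instead of [m = p]. *)
have p1 : p%:R / p.+1%:R = 1 - 1%:R / p.+1%:R :> R.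
  by rewrite -natr1; field; rewrite natr1 pnatr_eq0.
case: (itv_complement a10 ab1 b11 a20 ab2 b21 e) => [] [aE bE b1E]; subst.
  have [||fr _] := @two_rotations_mul _ g1 g2 a2 s t _ _ sE tE; [lra|lra|].
  apply: (@two_rotations_prod6 _ p p.+1 s t) => //.
  by rewrite -pE subr0.
have [||_ fr] := @two_rotations_mul _ g2 g1 a1 t s _ _ tE sE; [lra|lra|].
apply: (@two_rotations_prod6 _ 1 p.+1 t s) => //.
by rewrite -[1%:R / _](subKr 1) -p1 -pE subKr.
Qed.

End SixInvolutions.

Theorem theorem6 (R : realType) :
  [/\ (forall f : iet R, is_riet 3 f -> G0 f ->
         periodic f /\ prod_involutions 2 f),
      (exists f : iet R, [/\ is_riet 4 f, G0 f & ~ reversible f]) &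
      (forall (f g1 g2 : iet R) (a1 b1 a2 b2 : R) (p : nat),
         G0 f -> f = (g1 * g2)%g ->
         restricted_rotation g1 a1 b1 -> restricted_rotation g2 a2 b2 ->
         `[a2, b2[%classic = `[0, 1[%classic `\` `[a1, b1[%classic ->
         (0 < p)%N -> b1 - a1 = p%:R / p.+1%:R ->
         prod_involutions 6 f)].
Proof.
split.
- move=> f f3 f0; have fp := riet3_periodic f3 f0.
  by split=> //; exact: periodic_prod2.
- exact: exists_irreversible_4iet.
- move=> f g1 g2 a1 b1 a2 b2 p f0 fE r1 r2 e _.
  exact: restricted_rotations_prod6 f0 fE r1 r2 e.
Qed.
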